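(* Let $X$ be a building of finite rank and let $\xi$ be any point of $\mathscr{C}_{\mathrm{sph}}(X)$. Given any two spherical residues $x,y\in\mathrm{Res}_{\mathrm{sph}}(X)$, there exists $z\in\mathrm{Res}_{\mathrm{sph}}(X)$ such that $Q(z,\xi)\subset Q(x,\xi)\cap Q(y,\xi)$, where $Q(\cdot,\xi)$ denotes the combinatorial sector pointing to $\xi$.
   Context: Conventions on buildings. $X$ is a building of finite rank and of arbitrary type $(W,S)$ (not assumed locally finite), with its full apartment system. A residue of type $J\subset S$ is spherical if $W_J=\langle J\rangle$ is finite. Residues are viewed as simplices: we write $R\subset R'$ (''$R$ is contained in $R'$'') if, as sets of chambers, $R'$ is a subset of $R$; thus chambers are the maximal spherical residues. $\mathrm{Res}_{\mathrm{sph}}(X)$ denotes the set of spherical residues. The star $\mathrm{St}(\sigma)$ is the set of residues $R$ with $\sigma\subset R$ (including $\sigma$). For a chamber $C$, $\mathrm{proj}_\sigma(C)$ is the unique chamber of $\mathrm{St}(\sigma)$ nearest to $C$ for the gallery distance; for a spherical residue $R$, $\mathrm{proj}_\sigma(R)\in\mathrm{St}(\sigma)$ is the residue whose set of chambers is $\{\mathrm{proj}_\sigma(C) : C \text{ a chamber with } R\subset C\}$. Maximal combinatorial bordification. $\mathscr{C}_{\mathrm{sph}}(X)$ is the closure of the image of the injective map $\mathrm{Res}_{\mathrm{sph}}(X)\to\prod_{\sigma\in\mathrm{Res}_{\mathrm{sph}}(X)}\mathrm{St}(\sigma)$, $R\mapsto(\sigma\mapsto\mathrm{proj}_\sigma(R))$,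 with stars discrete and the product topology. $R_n\to\xi$ means that for each $\sigma$, $\mathrm{proj}_\sigma(R_n)=\xi(\sigma)$ for all large $n$. Combinatorial sectors. A set $\mathcal R$ of spherical residues is closed if $R_1\subset R_2\in\mathcal R$ implies $R_1\in\mathcal R$; it is convex if it is closed and $\mathrm{proj}_{R_1}(R_2)\in\mathcal R$ for all $R_1,R_2\in\mathcal R$. $\mathrm{Conv}(R_1,R_2)$ is the smallest convex set containing $R_1,R_2$. For $x\in\mathrm{Res}_{\mathrm{sph}}(X)$ and a sequence $(R_n)$ of spherical residues converging to $\xi$, the sector is $Q(x,\xi)=\bigcup_{k\ge0}\bigcap_{n\ge k}\mathrm{Conv}(x,R_n)$; it does not depend on the sequence, and equals the smallest closed set of spherical residues containing $x$ and containing $\xi(\sigma)$ whenever it contains $\sigma$. *)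

(* Defs.v *)
From mathcomp Require Import all_boot.
From mathcomp Require Import all_classical topology.

Set Implicit Arguments.
Unset Strict Implicit.
Unset Printing Implicit Defensive.

Local Open Scope classical_set_scope.
Local Open Scope group_scope.

(* Least element of a nonempty set of naturals (0 on the empty set). *)
Definition min_nat (A : set nat) : nat :=
  xget 0%N [set n | A n /\ forall m, A m -> (n <= m)%N].

(* Congruence on words over [S] generated by the relations (st)^(m s t) ~ 1;
   the value m s t = 0 stands for infinity and gives the trivial relation. *)
Inductive cox_equiv (S : Type) (m : S -> S -> nat) : seq S -> seq S -> Prop :=
| cox_refl u : cox_equiv m u u
| cox_sym u v : cox_equiv m u v -> cox_equiv m v u
| cox_trans u v w : cox_equiv m u v -> cox_equiv m v w -> cox_equiv m u w
| cox_rel u v s t :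
    cox_equiv m (u ++ flatten (nseq (m s t) [:: s; t]) ++ v) (u ++ v).

(* A Coxeter system (W, S) of finite rank: S is a finite set of generators of
   order 2 of the group W, and W has the presentation
   < S | (st)^m(s,t) >, where m(s,t) is the order of st (0 if infinite).
   As the generators are involutions, words without inverses suffice. *)
Record coxeter_system := CoxeterSystem {
  cox_group :> groupType;
  cox_index : finType;
  cox_gen : cox_index -> cox_group;
  cox_order : cox_index -> cox_index -> nat;
  cox_gen_inj : injective cox_gen;
  cox_gen_neq1 : forall s, cox_gen s <> 1;
  cox_gen_sq : forall s, cox_gen s * cox_gen s = 1;
  cox_generate : forall w, exists r, \prod_(s <- r) cox_gen s = w;
  cox_orderP : forall s t k,
    (cox_gen s * cox_gen t) ^+ k = 1 <-> (cox_order s t %| k)%N;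
  cox_presentation : forall r r',
    \prod_(s <- r) cox_gen s = \prod_(s <- r') cox_gen s ->
    cox_equiv cox_order r r'
}.

Definition cox_length (W : coxeter_system) (w : W) : nat :=
  min_nat (size @` [set r | \prod_(s <- r) @cox_gen W s = w]).

Definition parabolic (W : coxeter_system) (J : {set cox_index W}) : set W :=
  [set w | exists2 r, all (fun s => s \in J) r & \prod_(s <- r) cox_gen s = w].

(* A building of type (W, S) as a W-metric space; its apartments are then the
   subsets isometric to W, i.e. those of the full apartment system. *)
Record building (W : coxeter_system) := Building {
  chamber :> Type;
  wdist : chamber -> chamber -> W;
  chamber_inhabited : inhabited chamber;
  wdist_eq1 : forall C D, wdist C D = 1 <-> C = D;
  wdist_step : forall C C' D s, wdist C' C = cox_gen s ->
    wdist C' D = cox_gen s * wdist C D \/ wdist C' D = wdist C D;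
  wdist_step_up : forall C C' D s, wdist C' C = cox_gen s ->
    cox_length (cox_gen s * wdist C D) = (cox_length (wdist C D)).+1 ->
    wdist C' D = cox_gen s * wdist C D;
  wdist_ex : forall C D s, exists2 C',
    wdist C' C = cox_gen s & wdist C' D = cox_gen s * wdist C D
}.

Section Building.
Context {W : coxeter_system} (X : building W).

Definition adjacent (C D : X) : Prop := exists s, wdist C D = cox_gen s.

Definition gallery (C D : X) : set (seq X) :=
  [set p | path (fun A B => `[< adjacent A B >]) C p /\ last C p = D].

Definition gallery_dist (C D : X) : nat := min_nat (size @` gallery C D).

Definition residue (J : {set cox_index W}) (C : X) : set X :=
  [set D | parabolic J (wdist C D)].

(* Res_sph(X): a residue is identified with its set of chambers, which
   determines its type. *)
Definition sphres : set (set X) :=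
  [set R | exists J C, finite_set (parabolic J) /\ R = residue J C].

(* Simplicial inclusion, the reverse of the inclusion of chamber sets. *)
Definition face (R R' : sphres) : Prop := val R' `<=` val R.

(* St(sigma); every residue having [sigma] as a face is spherical. *)
Definition star (sigma : sphres) : set sphres := [set R | face sigma R].

Lemma star_self (sigma : sphres) : sigma \in star sigma.
Proof. by rewrite inE. Qed.

(* D is proj_sigma(C). *)
Definition is_proj_chamber (sigma : sphres) (C D : X) : Prop :=
  val sigma D /\
  forall E, val sigma E -> (gallery_dist C D <= gallery_dist C E)%N.

(* proj_sigma(R): the element of St(sigma) whose set of chambers is
   {proj_sigma(C) | C in R}; such an element always exists in a building, so
   that the default value [sigma] is never used. *)
Definition proj (sigma R : sphres) : star sigma :=
  xget (exist _ sigma (star_self sigma))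
    [set P : star sigma |
      val (val P) = [set D | exists2 C, val R C & is_proj_chamber sigma C D]].

Definition star_product : topologicalType :=
  prod_topology (fun sigma : sphres => discrete_topology (star sigma)).

Definition proj_map (R : sphres) : star_product := fun sigma => proj sigma R.

Definition bordification : set star_product := closure (range proj_map).

Definition converges_to (R : nat -> sphres) (xi : star_product) : Prop :=
  forall sigma, exists N, forall n, (N <= n)%N -> proj sigma (R n) = xi sigma.

Definition res_closed (A : set sphres) : Prop :=
  forall R1 R2, face R1 R2 -> A R2 -> A R1.

Definition res_convex (A : set sphres) : Prop :=
  res_closed A /\ forall R1 R2, A R1 -> A R2 -> A (val (proj R1 R2)).

Definition conv (R1 R2 : sphres) : set sphres :=
  smallest res_convex [set R1; R2].

Definition seq_sector (x : sphres) (R : nat -> sphres) : set sphres :=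
  \bigcup_k \bigcap_(n in [set n | (k <= n)%N]) conv x (R n).

(* Q(x, xi): [seq_sector x R] for a sequence R converging to [xi]. It does not
   depend on R, so the union over all such R is this common value. *)
Definition sector (x : sphres) (xi : star_product) : set sphres :=
  \bigcup_(R in [set R | converges_to R xi]) seq_sector x R.

End Building.

Arguments sphres {W} X.
Arguments bordification {W} X.

(* Main.v *)
(* Write Q'(x) for the closure of x under passing to faces and sigma |-> xi(sigma).
   It lies in Q(x, xi) computed with any sequence R_n -> xi, so it suffices to
   find z in both Q'(x) and Q'(y).

   For a chamber A let w_n(A) be the Weyl distance from A to its projection on
   R_n.  In the weak order of W, a nonempty set has a greatest lower bound; let
   j_N(A) be that of the w_n(A), n >= N.  Having bounded length, it is the
   position of a fixed chamber c_N(A) on the minimal galleries from A to R_n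
   for all large n.

   Call a residue rho parallel if xi(rho) = rho.  Then the w_n(A) agree for all
   A in rho, and moving forward from rho inside Q'(rho) one reaches a parallel
   residue containing every c_N(A), A in rho.  If A and B are adjacent through
   a panel sigma, then either sigma is parallel, or xi(sigma) is a chamber V and
   c_N(A) = c_N(V) = c_N(B); so for large N, c_N(A) and c_N(B) lie in a common
   parallel residue.  As two parallel residues sharing a chamber lie in a third
   one, this propagates along a gallery from xi(x) to xi(y), and yields a
   parallel residue z which is a face of an element of Q'(x) and of one of
   Q'(y). *)

Require Import Defs.
From mathcomp Require Import all_boot.
From mathcomp Require Import all_classical topology.
From mathcomp Require Import zify.

Set Implicit Arguments.
Unset Strict Implicit.
Unset Printing Implicit Defensive.

Local Open Scope classical_set_scope.
Local Open Scope group_scope.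

Lemma min_natP (A : set nat) n : A n ->
  A (min_nat A) /\ forall m, A m -> (min_nat A <= m)%N.
Proof.
move=> An.
have ex : exists n, `[< A n >] by exists n; apply/asboolP.
have [] : [set n | A n /\ forall m, A m -> (n <= m)%N] (min_nat A).
  apply: (@xgetI _ 0%N _ (ex_minn ex)).
  case: ex_minnP => m /asboolP Am mP; split=> // k Ak.
  by apply: mP; apply/asboolP.
by [].
Qed.

(** * Coxeter groups: words, length and the exchange condition *)

Section CoxeterGroup.
Context {W : coxeter_system}.
Local Notation S := (cox_index W).
Local Notation g := (@cox_gen W).
Local Notation l := (@cox_length W).
Local Notation "x * y" := (@mul W x y) : group_scope.
Implicit Types (u v w x y : W) (s t : S) (r : seq S) (J K L : {set S}).

(* Unlike [mulgA] and [invgM], these keep a single coercion path in the terms,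
   so that [lia] identifies equal lengths. *)
Lemma cox_mulA u v w : u * (v * w) = u * v * w.
Proof. exact: mulgA. Qed.

Lemma cox_invM u v : (u * v)^-1 = v^-1 * u^-1.
Proof. exact: invgM. Qed.

Definition word_prod r : W := \prod_(s <- r) g s.
Local Notation wd := word_prod.

Lemma gen_inv s : (g s)^-1 = g s.
Proof. by apply: mulg1_eq; apply: cox_gen_sq. Qed.

Lemma genK s w : g s * (g s * w) = w.
Proof. by rewrite cox_mulA cox_gen_sq mul1g. Qed.

Lemma genKr s w : w * g s * g s = w.
Proof. by rewrite -cox_mulA cox_gen_sq mulg1. Qed.

Lemma word_prod_nil : wd [::] = 1.
Proof. exact: big_nil. Qed.

Lemma word_prod_cons s r : wd (s :: r) = g s * wd r.
Proof. exact: big_cons. Qed.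

Lemma word_prod1 s : wd [:: s] = g s.
Proof. by rewrite word_prod_cons word_prod_nil mulg1. Qed.

Lemma word_prod_cat r1 r2 : wd (r1 ++ r2) = wd r1 * wd r2.
Proof. exact: big_cat. Qed.

Lemma word_prod_rev r : wd (rev r) = (wd r)^-1.
Proof.
elim: r => [|s r IH]; first by rewrite word_prod_nil invg1.
rewrite rev_cons -cats1 word_prod_cat word_prod_cons word_prod_nil mulg1 IH.
by rewrite word_prod_cons cox_invM gen_inv.
Qed.

(* The parity of the number of positions [i] in [r = s_1 ... s_k] at which
   [t] is the reflection [s_1 ... s_i ... s_1]; it only depends on [wd r],
   which is where the presentation is used. *)
Fixpoint reflection_parity r (t : W) : bool :=
  if r is s :: r' then (t == g s) (+) reflection_parity r' (g s * t * g s)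
  else false.

Lemma reflection_parity_cat r1 r2 (t : W) :
  reflection_parity (r1 ++ r2) t =
  reflection_parity r1 t (+) reflection_parity r2 ((wd r1)^-1 * t * wd r1).
Proof.
elim: r1 t => [|s r IH] t; first by rewrite word_prod_nil invg1 mul1g mulg1.
by rewrite /= IH addbA word_prod_cons cox_invM gen_inv !cox_mulA.
Qed.

(** The alternating word runs through the reflections [(g s * g t) ^+ i * g s]. When [k] is the
    order of st, the indices i and i + k give the same reflection and cancel, so the defining
    relations preserve the parity. *)
Lemma reflection_parity_alternating k s t x :
  reflection_parity (flatten (nseq k [:: s; t])) x =
  \big[addb/false]_(i < k.*2) (x == (g s * g t) ^+ i * g s).
Proof.
elim: k x => [|k IH] x; first by rewrite big_ord0.
rewrite /= IH doubleS !big_ord_recl /= expg0 mul1g; congr (_ (+) (_ (+) _)).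
  apply/eqP/eqP => [H|->].
    have -> : x = g s * (g s * x * g s) * g s.
      by rewrite !cox_mulA cox_gen_sq mul1g genKr.
    by rewrite H expg1.
  by rewrite expg1 !cox_mulA cox_gen_sq mul1g genKr.
apply: eq_bigr => i _; rewrite /bump /= !add1n.
set c := g s * g t; apply/eqP/eqP => [H|->].
  have -> : x = c * (g t * (g s * x * g s) * g t) * (g t * g s).
    by rewrite /c !cox_mulA !genKr cox_gen_sq mul1g.
  by rewrite H expgS expgSr /c !cox_mulA.
by rewrite expgS expgSr /c !cox_mulA !genKr cox_gen_sq mul1g.
Qed.

Lemma cox_equiv_invariant r r' : cox_equiv (@cox_order W) r r' ->
  wd r = wd r' /\ reflection_parity r =1 reflection_parity r'.
Proof.
elim=> {r r'} [r|r r' _ [e p]|r1 r2 r3 _ [e p] _ [e' p']|r1 r2 s t].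
- by [].
- by split=> // t; rewrite p.
- by rewrite e e'; split=> // t; rewrite p p'.
have /cox_orderP c1 := dvdnn (cox_order s t).
set m := cox_order s t in c1 *.
have wm : wd (flatten (nseq m [:: s; t])) = 1.
  rewrite -[RHS]c1; elim: (m) => [|k IH]; first by rewrite word_prod_nil.
  by rewrite /= !word_prod_cons IH expgS cox_mulA.
rewrite !word_prod_cat wm mul1g; split=> // x.
rewrite !reflection_parity_cat wm invg1 mul1g mulg1; congr (_ (+) _).
rewrite reflection_parity_alternating -addnn big_split_ord /=.
under [X in _ (+) X (+) _]eq_bigr => i _ do rewrite expgnDr c1 mul1g.
by rewrite addbb.
Qed.

Lemma reflection_parity_word_prod r r' (t : W) : wd r = wd r' ->
  reflection_parity r t = reflection_parity r' t.
Proof. by move=> /cox_presentation /cox_equiv_invariant [_ ->]. Qed.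

Lemma reflection_parity_delete r (t : W) : reflection_parity r t ->
  exists r1 (x : S) r2, r = r1 ++ x :: r2 /\ t * wd r = wd (r1 ++ r2).
Proof.
elim: r t => [//|s r IH] t /=; have [-> _|_ /IH] := eqVneq t (g s).
  by exists [::], s, r; rewrite word_prod_cons genK.
move=> [r1 [x [r2 [-> e]]]]; exists (s :: r1), x, r2; split=> //=.
by rewrite !word_prod_cons -e !cox_mulA cox_gen_sq mul1g.
Qed.

Lemma lengthP w : exists2 r, wd r = w & size r = l w.
Proof.
have [r0 e0] := cox_generate w.
have [|[r e e1] _] := @min_natP (size @` [set r | wd r = w]) (size r0).
  by exists r0.
by exists r.
Qed.

Lemma length_word_prod r : (l (wd r) <= size r)%N.
Proof.
have [_] := @min_natP (size @` [set r' | wd r' = wd r]) (size r)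
  (ex_intro2 _ _ r erefl erefl).
by apply; exists r.
Qed.

Lemma length1 : l 1 = 0%N.
Proof. by have := length_word_prod [::]; rewrite word_prod_nil leqn0 => /eqP. Qed.

Lemma length_eq0 w : l w = 0%N -> w = 1.
Proof. by have [r <- <-] := lengthP w => /size0nil ->; rewrite word_prod_nil. Qed.

Lemma lengthM u v : (l (u * v) <= l u + l v)%N.
Proof.
have [r <- <-] := lengthP u; have [r' <- <-] := lengthP v.
by rewrite -word_prod_cat -size_cat length_word_prod.
Qed.

Lemma lengthV w : l w^-1 = l w.
Proof.
suff H v : (l v^-1 <= l v)%N by have := H w; have := H w^-1; rewrite invgK; lia.
by have [r <- <-] := lengthP v; rewrite -word_prod_rev -size_rev length_word_prod.
Qed.

Lemma length_gen s : l (g s) = 1%N.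
Proof.
have := length_word_prod [:: s]; rewrite word_prod1 /=.
case E : (l (g s)) => [|[|//]] // _.
by case: (@cox_gen_neq1 W s); apply: length_eq0.
Qed.

Lemma exchange s r : (l (g s * wd r) <= l (wd r))%N ->
  exists r1 (x : S) r2, r = r1 ++ x :: r2 /\ g s * wd r = wd (r1 ++ r2).
Proof.
move=> ls; apply: reflection_parity_delete.
(* Parity is computed on [s :: r'] with [r'] reduced. Its first letter contributes [g s] once;
   another occurrence would delete a letter of [r'] and give too short a word for [wd r]. *)
have [r' e sz] := lengthP (g s * wd r).
have -> := @reflection_parity_word_prod r (s :: r') (g s).
  rewrite /= eqxx cox_gen_sq mul1g.
  case E : (reflection_parity r' (g s)) => //.
  have [r1 [x [r2 [er ew]]]] := reflection_parity_delete E.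
  have := length_word_prod (r1 ++ r2); rewrite -ew e genK.
  by move: sz ls; rewrite er !size_cat /=; lia.
by rewrite word_prod_cons e genK.
Qed.

Lemma length_gen_mul s w : l (g s * w) = (l w).+1 \/ (l (g s * w)).+1 = l w.
Proof.
have := lengthM (g s) w; have := lengthM (g s) (g s * w); rewrite genK length_gen.
move=> h1 h2; suff : l (g s * w) <> l w by lia.
move=> e; have [r er sz] := lengthP w.
have := @exchange s r; rewrite er e leqnn => /(_ isT) [r1 [x [r2 [e1 e2]]]].
have := length_word_prod (r1 ++ r2); rewrite -e2 e; move: sz.
by rewrite e1 !size_cat /=; lia.
Qed.

(** * Reduced products and the weak order *)

Definition reduced_mul u v : Prop := l (u * v) = (l u + l v)%N.

Definition weak_le u w : Prop := l w = (l u + l (u^-1 * w))%N.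

Definition descent s w : bool := (l (g s * w) < l w)%N.

Lemma reduced_mul1l w : reduced_mul 1 w.
Proof. by rewrite /reduced_mul mul1g length1. Qed.

Lemma reduced_mul1r w : reduced_mul w 1.
Proof. by rewrite /reduced_mul mulg1 length1 addn0. Qed.

Lemma reduced_mulA u v w : reduced_mul u v -> reduced_mul (u * v) w ->
  reduced_mul v w /\ reduced_mul u (v * w).
Proof.
rewrite /reduced_mul => e1 e2; have := lengthM v w.
by have := lengthM u (v * w); rewrite cox_mulA; lia.
Qed.

Lemma reduced_mulAr u v w : reduced_mul v w -> reduced_mul u (v * w) ->
  reduced_mul u v /\ reduced_mul (u * v) w.
Proof.
rewrite /reduced_mul => e1 e2; have := lengthM u v.
by have := lengthM (u * v) w; rewrite -cox_mulA; lia.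
Qed.

Lemma reduced_mulV u v : reduced_mul u v -> reduced_mul v^-1 u^-1.
Proof. by rewrite /reduced_mul -cox_invM !lengthV => ->; rewrite addnC. Qed.

Lemma weak_leP u w : weak_le u w <-> exists2 v, w = u * v & reduced_mul u v.
Proof.
split=> [h|[v -> h]]; last by rewrite /weak_le mulKg.
by exists (u^-1 * w); rewrite /reduced_mul mulVKg.
Qed.

Lemma weak_le_refl w : weak_le w w.
Proof. by apply/weak_leP; exists 1; rewrite ?mulg1 //; apply: reduced_mul1r. Qed.

Lemma weak_le1 w : weak_le 1 w.
Proof. by apply/weak_leP; exists w; rewrite ?mul1g //; apply: reduced_mul1l. Qed.

Lemma weak_le_trans u v w : weak_le u v -> weak_le v w -> weak_le u w.
Proof.
move=> /weak_leP [x -> h] /weak_leP [y -> h'].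
have [_ h2] := reduced_mulA h h'.
by apply/weak_leP; exists (x * y); rewrite ?cox_mulA.
Qed.

Lemma weak_le_length u w : weak_le u w -> (l w <= l u)%N -> u = w.
Proof.
move=> -> h; have /length_eq0 e : l (u^-1 * w) = 0%N by lia.
by rewrite -[w](mulVKg u) e mulg1.
Qed.

Lemma weak_le_reducedr u v w : reduced_mul u w -> weak_le v w -> reduced_mul u v.
Proof. by move=> h' /weak_leP [x e h]; rewrite e in h'; have [] := reduced_mulAr h h'. Qed.

Lemma weak_le_mul2l u v w : reduced_mul u v -> reduced_mul u w ->
  weak_le (u * v) (u * w) <-> weak_le v w.
Proof.
move=> h h'; split=> /weak_leP [x e h2]; apply/weak_leP; exists x.
- by apply: (mulgI u); rewrite cox_mulA.
- by have [] := reduced_mulA h h2.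
- by rewrite e cox_mulA.
- by rewrite e in h'; have [] := reduced_mulAr h2 h'.
Qed.

Lemma descentN s w : ~~ descent s w <-> reduced_mul (g s) w.
Proof.
rewrite /descent /reduced_mul length_gen -leqNgt.
by have := length_gen_mul s w; split; lia.
Qed.

Lemma descent_length s w : descent s w -> l w = (l (g s * w)).+1.
Proof. by rewrite /descent; have := length_gen_mul s w; lia. Qed.

Lemma weak_le_gen s w : weak_le (g s) w <-> descent s w.
Proof.
rewrite /weak_le length_gen gen_inv /descent.
by have := length_gen_mul s w; split; lia.
Qed.

Lemma descent_reduced s w : descent s w -> reduced_mul (g s) (g s * w).
Proof. by move=> /descent_length; rewrite /reduced_mul genK length_gen. Qed.

Lemma descent_mul s u v : descent s u -> reduced_mul u v -> descent s (u * v).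
Proof.
rewrite /descent /reduced_mul cox_mulA => h h'.
by have := lengthM (g s * u) v; lia.
Qed.

Lemma exists_descent w : w <> 1 -> exists s, descent s w.
Proof.
have [r <- sz] := lengthP w; case: r sz => [|s r] sz.
  by rewrite word_prod_nil.
exists s; rewrite /descent -sz word_prod_cons genK /=.
by have := length_word_prod r; lia.
Qed.

(** * Parabolic subgroups *)

Lemma parabolicP J w : parabolic J w <-> exists2 r, all (fun s => s \in J) r & wd r = w.
Proof. by []. Qed.

Lemma parabolic1 J : parabolic J (1 : W).
Proof. by apply/parabolicP; exists [::]; rewrite ?word_prod_nil. Qed.

Lemma parabolic_gen J s : s \in J -> parabolic J (g s).
Proof. by move=> sJ; apply/parabolicP; exists [:: s]; rewrite /= ?sJ ?word_prod1. Qed.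

Lemma parabolicM J u v : parabolic J u -> parabolic J v -> parabolic J (u * v).
Proof.
move=> /parabolicP [r rJ <-] /parabolicP [r' rJ' <-].
apply/parabolicP; exists (r ++ r'); last exact: word_prod_cat.
by rewrite all_cat rJ.
Qed.

Lemma parabolicV J u : parabolic J u -> parabolic J u^-1.
Proof.
move=> /parabolicP [r rJ <-]; apply/parabolicP.
by exists (rev r); rewrite ?all_rev ?word_prod_rev.
Qed.

Lemma parabolicS J K u : J \subset K -> parabolic J u -> parabolic K u.
Proof.
move=> /fintype.subsetP JK [r /allP rJ <-]; exists r => //.
by apply/allP => s /rJ /JK.
Qed.

Lemma parabolic_set0 u : parabolic finset.set0 u -> u = 1.
Proof.
move=> /parabolicP [[|s r] /= a <-]; first exact: word_prod_nil.
by rewrite finset.in_set0 in a.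
Qed.

Lemma parabolic_reduced J u : parabolic J u ->
  exists r, [/\ all (fun s => s \in J) r, wd r = u & size r = l u].
Proof.
move=> /parabolicP [r + <-]; elim: r => [|s r IH] /=.
  by exists [::]; rewrite word_prod_nil length1.
move=> /andP [sJ /IH [r' [a' e' sz']]]; rewrite word_prod_cons -e'.
case/boolP: (descent s (wd r')) => [d|/descentN h].
  have [|r1 [x [r2 [er ew]]]] := @exchange s r'.
    by move: d; rewrite /descent; lia.
  exists (r1 ++ r2); rewrite -ew; split=> //.
    by move: a'; rewrite er !all_cat /= => /andP[-> /andP[]].
  have := descent_length d; have := f_equal size er.
  by rewrite !size_cat /= e'; lia.
exists (s :: r'); rewrite word_prod_cons /= sJ a'; split=> //.
by rewrite h length_gen e' sz'.
Qed.

Lemma parabolic_ind J (P : W -> Prop) : P 1 ->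
  (forall s u, s \in J -> parabolic J u -> reduced_mul (g s) u -> P u -> P (g s * u)) ->
  forall u, parabolic J u -> P u.
Proof.
move=> P1 PS u /parabolic_reduced [r [a e sz]]; rewrite -e.
have {u e sz} : size r = l (wd r) by rewrite e.
elim: r a => [|s r IH] /=; first by rewrite word_prod_nil.
move=> /andP [sJ a]; rewrite word_prod_cons => e.
have h : size r = l (wd r).
  have := lengthM (g s) (wd r); have := length_word_prod r; rewrite -e length_gen; lia.
apply: PS => //; first by exists r.
  by rewrite /reduced_mul -e length_gen -h.
exact: IH.
Qed.

Lemma parabolic_letter J s : parabolic J (g s) -> s \in J.
Proof.
move=> /parabolic_reduced [r [a e sz]]; move: sz a e; rewrite length_gen.
case: r => [|t [|//]] //= _; rewrite andbT word_prod1 => tJ.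
by move=> /cox_gen_inj <-.
Qed.

Lemma parabolic_length1 J u : parabolic J u -> l u = 1%N ->
  exists2 s, s \in J & u = g s.
Proof.
move=> /parabolic_reduced [r [a e sz]] h; move: sz a; rewrite h.
by case: r e => [|t [|//]] //=; rewrite word_prod1 andbT => <- _ tJ; exists t.
Qed.

(** By [lmin_reduced], this local condition says that [w] is the shortest element of the coset W_J
    w. *)
Definition lmin J w := forall s, s \in J -> ~~ descent s w.

(** The letter deleted by [exchange] cannot lie in the reduced word of [u], since [g s * u] is
    longer than [u]; so it lies in [r2]. *)
Lemma exchange_reduced_word s u r2 : size r2 = l (wd r2) ->
  reduced_mul u (wd r2) -> descent s (u * wd r2) -> reduced_mul (g s) u ->
  exists q1 (x : S) q2, r2 = q1 ++ x :: q2 /\ g s * (u * wd r2) = u * wd (q1 ++ q2).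
Proof.
have [r1 <- sz1] := lengthP u.
move=> sz2 h d h'; have [|q1 [x [q2 [e1 e2]]]] := @exchange s (r1 ++ r2).
  by rewrite word_prod_cat; move: d; rewrite /descent; lia.
rewrite word_prod_cat in e2.
have [lt|le] := ltnP (size q1) (size r1).
  have e3 : r1 = q1 ++ x :: take (size r1 - (size q1).+1) q2.
    move/(f_equal (take (size r1))): e1; rewrite take_size_cat // => {1}->.
    rewrite take_cat ltnNge (ltnW lt) /=; congr (_ ++ _).
    by have -> : (size r1 - size q1 = (size r1 - (size q1).+1).+1)%N by lia.
  have e4 : drop (size r1 - (size q1).+1) q2 = r2.
    move/(f_equal (drop (size r1))): e1; rewrite drop_size_cat // => ->.
    rewrite drop_cat ltnNge (ltnW lt) /=.
    by have -> : (size r1 - size q1 = (size r1 - (size q1).+1).+1)%N by lia.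
  set q := take _ _ in e3; have e5 : g s * wd r1 = wd (q1 ++ q).
    apply: (mulIg (wd r2)); rewrite -word_prod_cat -cox_mulA e2 -catA.
    by rewrite -e4 cat_take_drop.
  have := length_word_prod (q1 ++ q); rewrite -e5 h' length_gen -sz1 e3 !size_cat /=; lia.
have e3 : q1 = r1 ++ drop (size r1) q1.
  move/(f_equal (take (size r1))): e1; rewrite take_size_cat // take_cat.
  case: ltnP => [lt e1|ge e1]; first by rewrite {1}e1 cat_take_drop.
  have es : size r1 = size q1 by lia.
  by move: e1; rewrite es subnn take0 cats0 drop_size cats0 => ->.
set q := drop _ _ in e3; have e4 : r2 = q ++ x :: q2.
  by move/(f_equal (drop (size r1))): e1; rewrite drop_size_cat // e3 -catA drop_size_cat.
by exists q, x, q2; rewrite e2 e3 -catA word_prod_cat.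
Qed.

Lemma exchange_parabolic L s u v : parabolic L v -> reduced_mul u v ->
  descent s (u * v) -> reduced_mul (g s) u ->
  exists v', [/\ g s * (u * v) = u * v', (l v' < l v)%N & parabolic L v'].
Proof.
move=> /parabolic_reduced [r2 [a <- sz2]] h d h'.
have [q1 [x [q2 [e1 e2]]]] := exchange_reduced_word sz2 h d h'.
exists (wd (q1 ++ q2)); split=> //.
  by rewrite -sz2 e1; have := length_word_prod (q1 ++ q2); rewrite !size_cat /=; lia.
exists (q1 ++ q2) => //.
by move: a; rewrite e1 !all_cat /= => /andP[-> /andP[]].
Qed.

Lemma exchange_reduced s u v : reduced_mul u v -> descent s (u * v) ->
  reduced_mul (g s) u -> exists2 v', g s * (u * v) = u * v' & (l v' < l v)%N.
Proof.
have [r <- _] := lengthP v => h d h'.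
have [|v' [e lt _]] := @exchange_parabolic (finset.setTfor S) _ _ _ _ h d h'.
  by exists r => //; apply/allP => t _; rewrite finset.in_setT.
by exists v'.
Qed.

(** Induction on [u]: if s were a descent of [u * w], exchange would make u^-1 s u w an element of
    the coset of [w] shorter than [w]. *)
Lemma coset_min_reduced J w : (forall u, parabolic J u -> (l w <= l (u * w))%N) ->
  forall u, parabolic J u -> reduced_mul u w.
Proof.
move=> wmin; apply: parabolic_ind; first exact: reduced_mul1l.
move=> s u sJ uJ su uw.
case/boolP: (descent s (u * w)) => [d|/descentN h].
  have [v' e lt] := exchange_reduced uw d su.
  have pu : parabolic J (u^-1 * g s * u).
    by apply: parabolicM => //; apply: parabolicM; [exact: parabolicV|exact: parabolic_gen].
  by have := wmin _ pu; rewrite -!cox_mulA e mulKg leqNgt lt.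
by have [] := reduced_mulAr uw h.
Qed.

Lemma coset_min_ex J w : exists u v, [/\ parabolic J u, w = u * v & lmin J v].
Proof.
have [|[u uJ e] minu] := @min_natP [set l (u * w) | u in parabolic J] (l w).
  by exists 1; rewrite ?mul1g //; apply: parabolic1.
exists u^-1, (u * w); split; [exact: parabolicV|by rewrite mulKg|].
move=> s sJ; rewrite /descent -leqNgt e; apply: minu.
by exists (g s * u); rewrite ?cox_mulA //; apply: parabolicM => //; apply: parabolic_gen.
Qed.

(** If [x * w] is shortest in the coset, the product w = x^-1 (x w) is reduced, so a first letter of
    x^-1, which lies in [J], would be a descent of [w]; hence x = 1. *)
Lemma lmin_reduced J w u : lmin J w -> parabolic J u -> reduced_mul u w.
Proof.
move=> wmin; apply: coset_min_reduced => {}u uJ.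
have [|[x xJ e] minx] := @min_natP [set l (u * w) | u in parabolic J] (l w).
  by exists 1; rewrite ?mul1g //; apply: parabolic1.
have h : reduced_mul x^-1 (x * w).
  apply: (@coset_min_reduced J); last exact: parabolicV.
  by move=> v vJ; rewrite e cox_mulA; apply: minx; exists (v * x) => //; apply: parabolicM.
have x1 : x = 1.
  apply: contrapT => xn1; have /exists_descent [s ds] : x^-1 <> 1.
    by move=> e1; apply: xn1; rewrite -[x]invgK e1 invg1.
  have := descent_mul ds h; rewrite mulKg; apply/negP; apply: wmin.
  have [r [a er sz]] := parabolic_reduced (parabolicV xJ).
  have [|q1 [y [q2 [e1 e2]]]] := @exchange s r.
    by rewrite er; move: ds; rewrite /descent; lia.
  apply: parabolic_letter; rewrite -[g s](mulgK x^-1) -{1}er e2 invgK.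
  apply: parabolicM => //; exists (q1 ++ q2) => //.
  by move: a; rewrite e1 !all_cat /= => /andP[-> /andP[]].
by rewrite -[w]mul1g -x1 e; apply: minx; exists u => //; rewrite x1 mul1g.
Qed.

(** Induction on [u] with w = u v: as s is a descent of u v but not of u, exchange shortens v to v'
    with w = (s u) v', and this product is reduced. *)
Lemma descents_weak_le J w : (forall s, s \in J -> descent s w) ->
  forall u, parabolic J u -> weak_le u w.
Proof.
move=> dw; apply: parabolic_ind; first exact: weak_le1.
move=> s u sJ uJ su /weak_leP [v ew uv].
have := dw s sJ; rewrite ew => d; have [v' e lt] := exchange_reduced uv d su.
have := descent_length d; rewrite e.
rewrite /weak_le su cox_invM gen_inv -cox_mulA e mulKg length_gen => h.
by move: uv; rewrite /reduced_mul; have := lengthM u v'; lia.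
Qed.

Lemma finite_length n : finite_set [set w : W | (l w <= n)%N].
Proof.
(* Words of length at most n are encoded as n-tuples padded with [None]. *)
pose f (q : n.-tuple (option S)) : W := wd (pmap id q).
apply: (@sub_finite_set _ _ (range f)); last first.
  exact: finite_image finite_finset.
move=> w /= lw; have [r e sz] := lengthP w.
have sz' : size (map Some r ++ nseq (n - size r) None) == n.
  by rewrite size_cat size_map size_nseq; apply/eqP; lia.
exists (Tuple sz') => //; rewrite /f /= pmap_cat -e.
have -> : pmap id (nseq (n - size r) (@None S)) = [::] by elim: (_ - _)%N.
by rewrite cats0; congr (wd _); elim: (r) => //= a q ->.
Qed.

Lemma descents_finite J w : (forall s, s \in J -> descent s w) ->
  finite_set (parabolic J : set W).
Proof.
move=> dw; apply: sub_finite_set (finite_length (l w)) => u uJ /=.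
by rewrite (descents_weak_le dw uJ); lia.
Qed.

Definition is_longest J w := parabolic J w /\ forall s, s \in J -> descent s w.

Lemma longest_ex J : finite_set (parabolic J : set W) -> exists w, is_longest J w.
Proof.
move=> fJ.
have [n nP] : exists n, forall u : W, parabolic J u -> (l u <= n)%N.
  have /finite_seqP [r er] := fJ; exists (\max_(u <- r) l u) => u.
  by rewrite er /= => ur; apply: leq_bigmax_seq.
have [|[u uJ e] minu] := @min_natP [set n - l u | u in parabolic J]%N (n - l (1 : W)).
  by exists 1 => //; apply: parabolic1.
exists u; split=> // s sJ.
have suJ : parabolic J (g s * u) by apply: parabolicM => //; apply: parabolic_gen.
have := minu (n - l (g s * u))%N; rewrite -e => /(_ (ex_intro2 _ _ _ suJ erefl)).
by rewrite /descent; have := nP _ suJ; have := nP _ uJ; have := length_gen_mul s u; lia.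
Qed.

Lemma longest_weak_le J w u : is_longest J w -> parabolic J u -> weak_le u w.
Proof. by move=> [_ dw]; apply: descents_weak_le. Qed.

Lemma longest_inv J w : is_longest J w -> w^-1 = w.
Proof.
move=> lw; apply: weak_le_length; last by rewrite lengthV.
by apply: (longest_weak_le lw); apply: parabolicV; case: lw.
Qed.

(** [g s * w] is below [w] and one shorter, so its complement w^-1 s w = w s w is a single
    letter. *)
Lemma longest_conj J w s : is_longest J w -> s \in J ->
  exists2 t, t \in J & w * g s * w = g t.
Proof.
move=> lw sJ; have [wJ dw] := lw; have wV := longest_inv lw.
have swJ : parabolic J (g s * w) by apply: parabolicM => //; apply: parabolic_gen.
have [||t tJ e] := @parabolic_length1 J (w * g s * w).
- by rewrite -cox_mulA; apply: parabolicM.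
- have := longest_weak_le lw swJ; rewrite /weak_le cox_invM gen_inv wV.
  by have := descent_length (dw s sJ); lia.
- by exists t.
Qed.

(** * Joins and meets in the weak order *)

Lemma weak_le_cons s u w : reduced_mul (g s) u ->
  weak_le (g s * u) w <-> descent s w /\ weak_le u (g s * w).
Proof.
move=> su; split=> [h|[/descent_reduced d h]]; last first.
  by rewrite -(genK s w) weak_le_mul2l.
have d : descent s w.
  apply/weak_le_gen; apply: weak_le_trans h.
  by apply/weak_leP; exists u.
split=> //; move: h; rewrite -{1}(genK s w) weak_le_mul2l //.
exact: descent_reduced.
Qed.

Lemma descent_weak_le s u w : descent s u -> weak_le u w -> descent s w.
Proof. by move=> /weak_le_gen h h'; apply/weak_le_gen; apply: weak_le_trans h'. Qed.

Lemma weak_le_tail s u w : descent s u ->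
  weak_le u w <-> descent s w /\ weak_le (g s * u) (g s * w).
Proof. by move=> d; rewrite -{1}(genK s u); apply: weak_le_cons; apply: descent_reduced. Qed.

(* The local case is that of two letters [s], [t]: if both are descents of
   [w0] then the longest element of <s, t> exists and lies below every upper
   bound of [s] and [t]. *)
Lemma weak_le_join u v w0 : weak_le u w0 -> weak_le v w0 ->
  exists j, [/\ weak_le u j, weak_le v j &
    forall w, weak_le u w -> weak_le v w -> weak_le j w].
Proof.
have [n] := ubnP (l w0); elim: n => // n IH in u v w0 *; move=> ln uw vw.
have [->|/eqP/exists_descent [s su]] := eqVneq u 1.
  by exists v; split=> //; [exact: weak_le1|exact: weak_le_refl].
have [->|/eqP/exists_descent [t tv]] := eqVneq v 1.
  by exists u; split=> //; [exact: weak_le_refl|exact: weak_le1].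
have step c a b : descent c a -> descent c b -> weak_le a w0 -> weak_le b w0 ->
    exists j, [/\ weak_le a j, weak_le b j &
      forall w, weak_le a w -> weak_le b w -> weak_le j w].
  move=> ca cb aw bw.
  have [d aw'] := (weak_le_tail w0 ca).1 aw.
  have [_ bw'] := (weak_le_tail w0 cb).1 bw.
  have [|j [aj bj jP]] := IH _ _ (g c * w0) _ aw' bw'.
    by move: d; rewrite /descent; lia.
  have cj : reduced_mul (g c) j.
    by apply: (weak_le_reducedr (descent_reduced d)); exact: jP.
  exists (g c * j); split=> [||w a1 b1].
  - by rewrite -(genK c a) weak_le_mul2l //; apply: descent_reduced.
  - by rewrite -(genK c b) weak_le_mul2l //; apply: descent_reduced.
  have [d1 a2] := (weak_le_tail w ca).1 a1.
  have [_ b2] := (weak_le_tail w cb).1 b1.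
  by apply/weak_le_cons => //; split=> //; apply: jP.
have descents w : weak_le u w -> weak_le v w ->
    forall c, c \in [set s; t]%SET -> descent c w.
  move=> a b c; rewrite finset.in_set2 => /orP[] /eqP ->.
    exact: descent_weak_le a.
  exact: descent_weak_le b.
have [d [dJ dd]] := longest_ex (descents_finite (descents w0 uw vw)).
have dle w : weak_le u w -> weak_le v w -> weak_le d w.
  by move=> a b; apply: (descents_weak_le (descents w a b)).
have sd : descent s d by apply: dd; rewrite finset.in_set2 eqxx.
have td : descent t d by apply: dd; rewrite finset.in_set2 eqxx orbT.
have [j1 [uj1 dj1 j1P]] := step s u d su sd uw (dle _ uw vw).
have [j2 [vj2 dj2 j2P]] := step t v d tv td vw (dle _ uw vw).
have [||j [j1j j2j jP]] := step s j1 j2 (descent_weak_le su uj1) (descent_weak_le sd dj2).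
- by apply: j1P => //; apply: dle.
- by apply: j2P => //; apply: dle.
exists j; split=> [||w a b].
- exact: weak_le_trans j1j.
- exact: weak_le_trans j2j.
- by apply: jP; [apply: j1P|apply: j2P] => //; apply: dle.
Qed.

Definition lower_bound (A : set W) u := forall w, A w -> weak_le u w.

Definition is_glb (A : set W) j :=
  lower_bound A j /\ forall u, lower_bound A u -> weak_le u j.

(** A lower bound of maximal length equals its join with any other lower bound, since that join is
    again a lower bound. *)
Lemma glb_ex (A : set W) : A !=set0 -> exists j, is_glb A j.
Proof.
move=> [w0 Aw0].
have [|[j jA jmin] minj] :=
  @min_natP [set l w0 - l u | u in lower_bound A]%N (l w0 - l (1 : W)).
  by exists 1 => // w _; apply: weak_le1.
exists j; split=> // u uA.
have [k [uk jk kP]] := weak_le_join (uA _ Aw0) (jA _ Aw0).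
have kA : lower_bound A k by move=> w Aw; apply: kP; [apply: uA|apply: jA].
suff -> : j = k by [].
apply: weak_le_length => //.
have := minj (l w0 - l k)%N (ex_intro2 _ _ _ kA erefl).
by rewrite -jmin; have := kA _ Aw0; have := jA _ Aw0; rewrite /weak_le; lia.
Qed.

Lemma glb_unique (A : set W) i j : is_glb A i -> is_glb A j -> i = j.
Proof.
move=> [iA imax] [jA jmax]; apply: weak_le_length; first exact: jmax.
by rewrite (imax _ jA); lia.
Qed.

(** Strips a common prefix: [u] is itself a lower bound of [A], and left multiplication by [u]
    preserves and reflects the order where it is reduced. *)
Lemma glb_mul (A B : set W) u j :
  (forall w, A w <-> exists2 v, B v & w = u * v) ->
  (forall v, B v -> reduced_mul u v) -> is_glb A j -> B !=set0 ->
  exists k, [/\ j = u * k, reduced_mul u k & is_glb B k].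
Proof.
move=> AB red [jA jmax] [v0 Bv0].
have [k ej uk] : exists2 k, j = u * k & reduced_mul u k.
  apply/weak_leP; apply: jmax => w /AB [v Bv ->].
  by apply/weak_leP; exists v => //; apply: red.
exists k; split=> //; split=> [v Bv|y yB].
  by apply/(weak_le_mul2l uk (red _ Bv)); rewrite -ej; apply: jA; apply/AB; exists v.
have uy : reduced_mul u y by apply: (weak_le_reducedr (red _ Bv0)); apply: yB.
apply/(weak_le_mul2l uy uk); rewrite -ej; apply: jmax => w /AB [v Bv ->].
by apply/(weak_le_mul2l uy (red _ Bv)); apply: yB.
Qed.

(** * Transport of parabolic subgroups *)

Definition rmin L w := forall u, parabolic L u -> reduced_mul w u.

(* [w] is minimal in [W_K w] and [w^-1 K w] consists of generators in [L]: in
   terms of residues, this says that the projection from the residue of type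
   [L] at the end of a gallery of type [w] to the one of type [K] at its
   beginning is onto. *)
Definition transports K L w :=
  lmin K w /\ forall t, t \in K -> exists2 t', t' \in L & g t * w = w * g t'.

Lemma lmin_prefix K u w : lmin K w -> weak_le u w -> lmin K u.
Proof. by move=> h uw s sK; apply: contra (h s sK) => d; apply: descent_weak_le uw. Qed.

Lemma lminS J K w : J \subset K -> lmin K w -> lmin J w.
Proof. by move=> /fintype.subsetP JK h s /JK; apply: h. Qed.

Lemma rmin_suffix L u w : reduced_mul u w -> rmin L (u * w) -> rmin L w.
Proof. by move=> uw h x /h h'; have [] := reduced_mulA uw h'. Qed.

(** Widening [L] to all letters gives one condition on positions that serves all [R n], whose types
    vary with n. *)
Lemma transports_setT K L w : transports K L w -> transports K [set: S]%SET w.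
Proof.
move=> [h tr]; split=> // t /tr [t' _ e].
by exists t'; rewrite ?finset.in_setT.
Qed.

Lemma transports_word K L w r : transports K L w -> all (fun s => s \in K) r ->
  exists r', [/\ all (fun s => s \in L) r', size r' = size r & wd r * w = w * wd r'].
Proof.
move=> [_ tr]; elim: r => [|s r IH] /=.
  by exists [::]; rewrite word_prod_nil mul1g mulg1.
move=> /andP [/tr [t tL et] /IH [r' [aL sz er]]]; exists (t :: r').
rewrite /= tL aL sz; split=> //.
by rewrite !word_prod_cons -cox_mulA er cox_mulA et -cox_mulA.
Qed.

Lemma transports_conj K L w k : transports K L w -> parabolic K k ->
  exists x, [/\ parabolic L x, k * w = w * x, l x = l k & reduced_mul w x].
Proof.
move=> tr kK; have [r [a e sz]] := parabolic_reduced kK.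
have [r' [aL sz' er]] := transports_word tr a; rewrite e in er.
have := lmin_reduced tr.1 kK; have := lengthM w (wd r'); have := length_word_prod r'.
rewrite /reduced_mul er => h1 h2 h3.
exists (wd r'); rewrite /reduced_mul; split=> //; [by exists r'|lia|lia].
Qed.

Lemma rmin_reflection L w t u : rmin L w -> parabolic L u -> ~~ descent t w ->
  g t * w = w * u -> exists2 t', t' \in L & g t * w = w * g t'.
Proof.
move=> rm uL /descentN; rewrite /reduced_mul => + e; rewrite e rm // length_gen => h.
have [|t' t'L eu] := parabolic_length1 uL; first by lia.
by exists t'; rewrite ?eu.
Qed.

(** This is the intersection of J with w L w^-1. For [w] minimal on both sides it is the type of the
    projection of a residue of type [L] to one of type [J] ([proj_residue]). *)
Definition proj_type J L w : {set S} :=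
  [set t in J | `[< exists2 t', t' \in L & g t * w = w * g t' >]]%SET.

(** Induction on the length of [u]: a descent t in [J] of [w * u] is not one of [w], so exchange
    shortens [u] and puts t w in w W_L. By [rmin_reflection], t is then in [proj_type]. *)
Lemma double_coset_split J L w u : rmin L w -> lmin J w -> parabolic L u ->
  exists k v, [/\ parabolic (proj_type J L w) k, parabolic L v,
    w * u = k * (w * v) & lmin J (w * v)].
Proof.
move=> rm lm; have [n] := ubnP (l u); elim: n => // n IH in u *; move=> ln uL.
have [h|/existsNP [t /not_implyP [tJ /negP]]] := pselect (lmin J (w * u)).
  by exists 1, u; split=> //; [exact: parabolic1|rewrite mul1g].
rewrite negbK => d.
have [v [e lv vL]] := exchange_parabolic uL (rm _ uL) d ((descentN _ _).1 (lm t tJ)).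
have [|k [v' [kI v'L ev lv']]] := IH v _ vL; first by lia.
exists (g t * k), v'; split=> //.
  apply: parabolicM kI; apply: parabolic_gen; rewrite finset.inE tJ /=.
  apply/asboolP; apply: (rmin_reflection rm (u := v * u^-1)) (lm t tJ) _.
    by apply: parabolicM => //; apply: parabolicV.
  by rewrite cox_mulA -e -!cox_mulA mulgV mulg1.
by rewrite -cox_mulA -ev -e genK.
Qed.

(** * Splitting off the prefix w_K w_J *)

Section Step.
Variables (K : {set S}) (s : S) (wK : W).
Local Notation J := (s |: K)%SET.
Hypothesis lK : is_longest K wK.

(* Here [w_K w] has all of [K] as descents because [w] is minimal in [W_K w],
   and also [s], because [w_K w = w x] is reduced. *)
Lemma step_descents L w : transports K L w -> descent s w ->
  forall t, t \in J -> descent t (wK * w).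
Proof.
move=> tr d t; rewrite finset.in_setU1 => /orP [/eqP ->|tK].
  have [x [_ -> _ wx]] := transports_conj tr lK.1.
  exact: descent_mul.
by apply: descent_mul; [exact: lK.2|exact: lmin_reduced tr.1 lK.1].
Qed.

Lemma step_finite L w : transports K L w -> descent s w ->
  finite_set (parabolic J : set W).
Proof. by move=> tr d; exact: descents_finite (step_descents tr d). Qed.

Variable wJ : W.
Hypothesis lJ : is_longest J wJ.
Local Notation i := (wK * wJ).

(** This is w_J K w_J, the type opposite to [K] in [J], because conjugation by w_K preserves [K]. *)
Definition step_type : {set S} :=
  [set t in J | `[< exists2 t0, t0 \in K & g t0 * i = i * g t >]]%SET.

Lemma longest_sq K' w : is_longest K' w -> w * w = 1.
Proof. by move=> /longest_inv e; rewrite -{1}e mulVg. Qed.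

(** By [step_descents], [wJ] is a prefix of [wK * w]; multiplying by the involution [wK] turns it
    into the prefix [i] of [w]. A letter of [J] cannot begin [m], as it would shorten [wJ]. *)
Lemma step_split L w : transports K L w -> descent s w ->
  exists m, [/\ w = i * m, reduced_mul i m, wK * w = wJ * m & lmin J m].
Proof.
move=> tr d; have wKJ : weak_le wK wJ.
  by apply: (longest_weak_le lJ); apply: parabolicS lK.1; apply: finset.subsetU1.
have /weak_leP [m em jm] : weak_le wJ (wK * w).
  exact: descents_weak_le (step_descents tr d) _ lJ.1.
have ew : w = i * m by rewrite -cox_mulA -em cox_mulA (longest_sq lK) mul1g.
exists m; split=> //.
  have := lmin_reduced tr.1 lK.1; move: jm wKJ.
  rewrite /reduced_mul /weak_le (longest_inv lK) -ew em; lia.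
move=> t tJ; apply/negP => /weak_le_gen tm.
have := weak_le_reducedr jm tm; rewrite /reduced_mul length_gen.
have := lengthV (g t * wJ); rewrite cox_invM gen_inv (longest_inv lJ).
by have := descent_length (lJ.2 t tJ); lia.
Qed.

Lemma step_type_sub : step_type \subset J.
Proof. by apply/fintype.subsetP => t; rewrite finset.inE => /andP[]. Qed.

Lemma step_typeP t : t \in step_type -> exists2 t0, t0 \in K & g t0 * i = i * g t.
Proof. by rewrite finset.inE => /andP [_ /asboolP]. Qed.

Lemma longest_conj_mul K' w t t' : is_longest K' w -> w * g t * w = g t' ->
  w * g t = g t' * w /\ g t * w = w * g t'.
Proof.
move=> lw <-; have e := longest_sq lw.
by rewrite -!cox_mulA e mulg1 !cox_mulA e mul1g.
Qed.

Lemma step_transports L w m : transports K L w -> descent s w -> w = i * m ->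
  transports step_type L m.
Proof.
move=> tr d ew; have [m' [ew' im _ lm]] := step_split tr d.
have {ew'} em : m' = m by apply: (mulgI i); rewrite -[LHS]ew' ew.
rewrite em in im lm; split=> [|t /step_typeP [t0 /tr.2 [t' t'L e0] e]].
  exact: lminS step_type_sub lm.
exists t' => //; apply: (mulgI i).
by rewrite -[LHS]/(i * (g t * m)) cox_mulA -e -cox_mulA -ew e0 ew -!cox_mulA.
Qed.

(** Conjugating t by w_J gives a letter of [K], as wanted, or s. In the latter case s w lies in w
    W_L, where [w] is shortest, against [descent s w]. With [step_transports], this identifies
    [proj_type J L m] with [step_type]. *)
Lemma step_type_max L w m t t' : transports K L w -> rmin L w -> descent s w ->
  w = i * m -> t \in J -> t' \in L -> g t * m = m * g t' -> t \in step_type.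
Proof.
move=> tr rm d ew tJ t'L e; have [t0 t0J et0] := longest_conj lJ tJ.
have [e1 e2] := longest_conj_mul lJ et0.
move: t0J; rewrite finset.in_setU1 => /orP [/eqP e0|t0K]; last first.
  have [t1 t1K /(longest_conj_mul lK) [e3 _]] := longest_conj lK t0K.
  rewrite finset.inE tJ; apply/asboolP; exists t1 => //.
  by rewrite cox_mulA -e3 -!cox_mulA e1.
have [x [xL ex _ _]] := transports_conj tr lK.1.
have ev : wK * w = wJ * m by rewrite ew !cox_mulA (longest_sq lK) mul1g.
have esw : g s * w = w * (x * g t' * x^-1).
  apply: (mulIg x); rewrite -[LHS]/(g s * w * x) -[RHS]/(w * _ * x).
  rewrite -!cox_mulA mulVg mulg1 -ex ev -e0 cox_mulA -e1 -cox_mulA e.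
  by rewrite cox_mulA -ev ex -cox_mulA.
move: d; rewrite /descent esw rm ?ltnNge ?leq_addr //.
by apply: parabolicM; [apply: parabolicM => //; exact: parabolic_gen|exact: parabolicV].
Qed.

End Step.

End CoxeterGroup.

(** * Buildings: composing and splitting Weyl distances *)

Section BuildingTheory.
Context {W : coxeter_system} (X : building W).
Local Notation S := (cox_index W).
Local Notation g := (@cox_gen W).
Local Notation l := (@cox_length W).
Local Notation d := (@wdist W X).
Local Notation "x * y" := (@mul W x y) : group_scope.
Local Notation proj := (@Defs.proj W X).
Implicit Types (u v w : W) (s t : S) (J K L I : {set S}) (A B C D : X) (R : set X).

Lemma wdistxx C : d C C = 1.
Proof. exact/wdist_eq1. Qed.

Lemma wdist_gen_sym C D s : d C D = g s -> d D C = g s.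
Proof.
move=> e; have [] := wdist_step C e; rewrite wdistxx => /esym h.
  by rewrite -(genK s (d D C)) h mulg1.
move/wdist_eq1: h => h; case: (@cox_gen_neq1 W s).
by rewrite -e h wdistxx.
Qed.

Lemma wdist_cons A B C s : d A B = g s -> reduced_mul (g s) (d B C) ->
  d A C = g s * d B C.
Proof.
by move=> e h; apply: wdist_step_up => //; rewrite h length_gen.
Qed.

Lemma wdist_split A C u v : d A C = u * v -> reduced_mul u v ->
  exists2 B, d A B = u & d B C = v.
Proof.
have [n] := ubnP (l u); elim: n => // n IH in A u *; move=> ln e h.
have [u1|/eqP/exists_descent [s su]] := eqVneq u 1.
  by exists A; [rewrite u1 wdistxx|rewrite e u1 mul1g].
have su' := descent_reduced su; rewrite -(genK s u) in h e.
have [h1 h2] := reduced_mulA su' h.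
have [A' eA eA'] := wdist_ex A C s.
have [||B eB eB'] := IH A' (g s * u) _ _ h1.
- by move: su; rewrite /descent; lia.
- by rewrite eA' e -cox_mulA genK.
exists B => //; rewrite -[RHS](genK s) -eB; apply: wdist_cons.
  exact: wdist_gen_sym.
by rewrite eB.
Qed.

Lemma wdist_comp A B C : reduced_mul (d A B) (d B C) -> d A C = d A B * d B C.
Proof.
have [n] := ubnP (l (d A B)); elim: n => // n IH in A *; move=> ln h.
have [u1|/eqP/exists_descent [s su]] := eqVneq (d A B) 1.
  by rewrite u1 mul1g; move/wdist_eq1: u1 => ->.
have su' := descent_reduced su; rewrite -(genK s (d A B)) in h.
have [h1 h2] := reduced_mulA su' h.
have [A' eA eA'] := wdist_ex A B s; rewrite -eA' in h1 h2.
have e1 : d A' C = d A' B * d B C.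
  by apply: IH h1; rewrite eA'; move: su; rewrite /descent; lia.
rewrite -[d A B](genK s) -eA' -cox_mulA -e1; apply: wdist_cons.
  exact: wdist_gen_sym.
by rewrite e1.
Qed.

Lemma wdistV C D : d D C = (d C D)^-1.
Proof.
have [n] := ubnP (l (d C D)); elim: n => // n IH in C *; move=> ln.
have [u1|/eqP/exists_descent [s su]] := eqVneq (d C D) 1.
  by rewrite u1 invg1; move/wdist_eq1: u1 => ->; apply: wdistxx.
have [C' eC eC'] := wdist_ex C D s.
have e : d D C' = (g s * d C D)^-1.
  by rewrite -eC'; apply: IH; rewrite eC'; move: su; rewrite /descent; lia.
rewrite (@wdist_comp D C' C) e eC.
  by rewrite -{2}[g s]gen_inv -cox_invM genK.
rewrite -{2}[g s]gen_inv; apply: reduced_mulV; exact: descent_reduced.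
Qed.

Lemma wdist_split_unique A B B' C : d A B = d A B' -> d B C = d B' C ->
  reduced_mul (d A B) (d B C) -> B = B'.
Proof.
have [n] := ubnP (l (d A B)); elim: n => // n IH in A B B' *; move=> ln e e' h.
have [u1|/eqP/exists_descent [s su]] := eqVneq (d A B) 1.
  by move: (u1); rewrite e => /wdist_eq1 <-; move/wdist_eq1: u1.
have su' := descent_reduced su; rewrite -(genK s (d A B)) in h.
have [h1 h2] := reduced_mulA su' h.
have [A1 eA eA1] := wdist_ex A B s; have [A2 eA' eA2] := wdist_ex A B' s.
rewrite -e in eA2; rewrite -eA1 in h1 h2.
have e1 : d A1 C = d A1 B * d B C by apply: wdist_comp.
have e2 : d A2 C = d A2 B' * d B' C by apply: wdist_comp; rewrite eA2 -eA1 -e'.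
have e12 : d A1 C = d A2 C by rewrite e1 e2 eA1 eA2 e'.
suff A12 : A1 = A2.
  apply: (IH A1) => //; last by rewrite A12 eA2 -A12.
  by rewrite eA1; move: su; rewrite /descent; lia.
(* [A1] and [A2] are both s-adjacent to [A]. Were they different, d A1 A2 = s would give d A1 C = s
   d A2 C, while these two distances are equal. *)
apply/wdist_eq1; have [] := wdist_step A2 eA; rewrite (wdist_gen_sym eA').
  by rewrite cox_gen_sq.
move=> eA12; have := @wdist_cons A1 A2 C s eA12; rewrite -e12 e1 => /(_ h2).
move=> /esym; rewrite -[RHS]mul1g => /mulIg e0; case: (@cox_gen_neq1 W s e0).
Qed.

Lemma wdist_exists C u : exists D, d C D = u.
Proof.
have [n] := ubnP (l u); elim: n => // n IH in C u *; move=> ln.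
have [->|/eqP/exists_descent [s su]] := eqVneq u 1.
  by exists C; apply: wdistxx.
have [C' eC _] := wdist_ex C C s.
have [|D eD] := IH C' (g s * u); first by move: su; rewrite /descent; lia.
exists D; rewrite -(genK s u) -eD; apply: wdist_cons; first exact: wdist_gen_sym.
by rewrite eD; apply: descent_reduced.
Qed.

Lemma wdist_parabolic J A B C : parabolic J (d A B) ->
  exists2 k, parabolic J k & d A C = k * d B C.
Proof.
move=> uJ; have [u e] : exists u, d A B = u by exists (d A B).
rewrite e in uJ; move: u uJ A e.
apply: parabolic_ind => [A /wdist_eq1 ->|s u sJ uJ su IH A e].
  by exists 1; rewrite ?mul1g //; apply: parabolic1.
have [A1 eA1 /IH [k kJ ek]] := wdist_split e su.
have [] := wdist_step C eA1; rewrite ek => ->; last by exists k.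
by exists (g s * k); rewrite ?cox_mulA //; apply: parabolicM => //; apply: parabolic_gen.
Qed.

Lemma residue_refl J C : residue J C C.
Proof. by rewrite /residue /= wdistxx; apply: parabolic1. Qed.

Lemma residue_sym J C D : residue J C D -> residue J D C.
Proof. by rewrite /residue /= (wdistV C D); apply: parabolicV. Qed.

Lemma residue_trans J B C D : residue J B C -> residue J C D -> residue J B D.
Proof.
rewrite /residue /= => /(@wdist_parabolic _ _ _ D) [k kJ ->]; exact: parabolicM.
Qed.

Lemma residue_eq J C D : residue J C D -> residue J C = residue J D.
Proof.
move=> h; apply/seteqP; split=> B; first exact: residue_trans (residue_sym h).
exact: residue_trans h.
Qed.

Lemma residueS J K C : J \subset K -> residue J C `<=` residue K C.
Proof. by move=> JK D; apply: parabolicS. Qed.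

Lemma residue_set0 C D : residue finset.set0 C D -> C = D.
Proof. by move=> /parabolic_set0 /wdist_eq1. Qed.

(** * Gates and projections *)

(** A form of the nearest-chamber property that composes with Weyl distances; [is_proj_chamberP]
    matches it with projections. *)
Definition gate R A C :=
  R C /\ forall D, R D -> d A D = d A C * d C D /\ reduced_mul (d A C) (d C D).

Lemma gate_sub R R' A C : R' `<=` R -> R' C -> gate R A C -> gate R' A C.
Proof. by move=> sub R'C [_ h]; split=> // D /sub /h. Qed.

Lemma gate_unique R A C D : gate R A C -> gate R A D -> C = D.
Proof.
move=> [RC hC] [RD hD]; have [e1 h1] := hC D RD; have [e2 h2] := hD C RC.
apply/wdist_eq1/length_eq0.
by move: h1 h2; rewrite /reduced_mul -e1 -e2 => -> ; lia.
Qed.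

Lemma rmin_lmin L w : rmin L w <-> lmin L w^-1.
Proof.
split=> [h s sL|h u uL].
  by apply/descentN; rewrite -[g s]gen_inv; apply/reduced_mulV/h/parabolic_gen.
by rewrite -[w]invgK -[u]invgK; apply/reduced_mulV/(lmin_reduced h)/parabolicV.
Qed.

Lemma gate_rmin J B A C : residue J B C -> gate (residue J B) A C <-> rmin J (d A C).
Proof.
move=> BC; rewrite (residue_eq BC); split=> [[_ h] u uJ|h].
  by have [D eD] := wdist_exists C u; have [] := h D; rewrite /residue /= eD.
split=> [|D /h r]; first exact: residue_refl.
by split=> //; apply: wdist_comp.
Qed.

Lemma gate_lmin J B A C : residue J B C -> gate (residue J B) A C <-> lmin J (d C A).
Proof. by move=> BC; rewrite (wdistV A C) -rmin_lmin; apply: gate_rmin. Qed.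

Lemma gate_ex J B A : exists C, gate (residue J B) A C.
Proof.
have [u [v [uJ e vmin]]] := coset_min_ex J (d B A).
have [C eC eC'] := wdist_split e (lmin_reduced vmin uJ).
exists C; apply/gate_lmin; rewrite ?eC' //.
by rewrite /residue /= eC.
Qed.

Lemma gate_dist R A C D : gate R A C -> R D -> (l (d A D) <= l (d A C))%N -> D = C.
Proof.
move=> [_ h] /h [-> r]; rewrite r => le; apply/esym/wdist_eq1/length_eq0; lia.
Qed.

Lemma gallery_length C D p : gallery C D p -> (l (d C D) <= size p)%N.
Proof.
move=> [+ <-]; elim: p C => [|B p IH] C /=; first by rewrite wdistxx length1.
move=> /andP [/asboolP [s e] /IH le].
have := lengthM (g s) (d B (last B p)); rewrite length_gen.
by have [] := wdist_step (last B p) e; move=> ->; lia.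
Qed.

Lemma gallery_ex C D : exists2 p, gallery C D p & size p = l (d C D).
Proof.
have [n] := ubnP (l (d C D)); elim: n => // n IH in C *; move=> ln.
have [u1|/eqP/exists_descent [s su]] := eqVneq (d C D) 1.
  by exists [::]; rewrite ?u1 ?length1 //; split=> //; apply/wdist_eq1.
have [C' eC eC'] := wdist_ex C D s; have lC := descent_length su.
have [|p [pp lp] sz] := IH C'; first by rewrite eC'; lia.
exists (C' :: p); last by rewrite /= sz eC' lC.
split=> //=; rewrite pp andbT; apply/asboolP; exists s; exact: wdist_gen_sym.
Qed.

Lemma gallery_distE C D : gallery_dist C D = l (d C D).
Proof.
have [p gp sz] := gallery_ex C D.
have ep : (size @` gallery C D) (size p) by exists p.
have [[q gq eq] minq] := min_natP ep.
have := gallery_length gq; have := minq _ ep; rewrite -sz -eq /gallery_dist -eq.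
by move=> le1 le2; apply/eqP; rewrite eqn_leq le1.
Qed.

Lemma sphresP (R : sphres X) :
  exists J C, finite_set (parabolic J : set W) /\ val R = residue J C.
Proof. by have := valP R; rewrite inE. Qed.

Lemma sphres_residue (R : sphres X) C : val R C ->
  exists J, finite_set (parabolic J : set W) /\ val R = residue J C.
Proof.
have [J [D [fJ e]]] := sphresP R; rewrite e => /residue_eq ->.
by exists J.
Qed.

Lemma residue_sphres J C : finite_set (parabolic J : set W) ->
  exists R : sphres X, val R = residue J C.
Proof.
move=> fJ; have h : residue J C \in @sphres W X by rewrite inE; exists J, C.
by exists (exist (fun R => R \in @sphres W X) _ h).
Qed.

Lemma sphres_inhabited (R : sphres X) : exists C, val R C.
Proof. by have [J [C [_ ->]]] := sphresP R; exists C; apply: residue_refl. Qed.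

Lemma is_proj_chamberP (sigma : sphres X) C D :
  is_proj_chamber sigma C D <-> gate (val sigma) C D.
Proof.
have [J [B [_ e]]] := sphresP sigma; have [D0 g0] := gate_ex J B C.
rewrite /is_proj_chamber e; split=> [[RD minD]|gD].
  suff -> : D = D0 by [].
  by apply: (gate_dist g0 RD); have := minD D0 g0.1; rewrite !gallery_distE.
by split=> [|E /gD.2 [eE r]]; [case: gD|rewrite !gallery_distE eE r leq_addr].
Qed.

(** With w = d A C, moving the start by k in W_K moves the end by x = w^-1 k w in W_L and keeps the
    distance w; both gates then follow from the minimality of w. *)
Lemma transports_proj K L A B C R : residue L B = R -> gate R A C ->
  transports K L (d A C) -> forall A', residue K A A' ->
  exists C', [/\ gate R A' C', d A' C' = d A C & gate (residue K A) C' A'].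
Proof.
move=> eR gC tr A' AA'; have RC := gC.1; rewrite -eR in gC RC *.
have kK : parabolic K (d A' A) by apply: residue_sym.
have [x [xL ex _ rx]] := transports_conj tr kK.
have eA'C : d A' C = d A C * x.
  by rewrite (@wdist_comp A' A C) ?ex //; exact: lmin_reduced tr.1 kK.
have [C' e1 e2] := wdist_split eA'C rx.
have RC' : residue L B C'.
  apply: (residue_trans RC); apply: residue_sym; by rewrite /residue /= e2.
exists C'; split=> //.
  by apply/(gate_rmin _ RC'); rewrite e1; apply/(gate_rmin _ RC).
by apply/(gate_lmin _ AA'); rewrite e1; apply: tr.1.
Qed.

(** A converse of [transports_proj]. For A' t-adjacent to [A], pick C' in [R] projecting to A'. Then
    t is a descent of d A C' but not of w = d A C, so exchange acts in the factor d C C' and puts t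
    w in w W_L. *)
Lemma proj_transports K L A B C R : residue L B = R -> gate R A C ->
  (forall A', residue K A A' -> exists2 C', R C' & gate (residue K A) C' A') ->
  transports K L (d A C).
Proof.
move=> eR gC par; have rm : rmin L (d A C).
  by have := gC; rewrite -eR => gC'; apply/(gate_rmin _ gC'.1).
have lm : lmin K (d A C).
  have [C' RC' /(gate_lmin _ (residue_refl _ _)) h] := par A (residue_refl _ _).
  by apply: lmin_prefix h _; apply/weak_leP; exists (d C C'); have [] := gC.2 _ RC'.
split=> // t tK; have [A' eA'] := wdist_exists A (g t).
have rA' : residue K A A' by rewrite /residue /= eA'; apply: parabolic_gen.
have [C' RC' gA'] := par A' rA'.
have uL : parabolic L (d C C').
  have := gC.1; rewrite -eR => rC; rewrite -eR in RC'.
  exact: residue_trans (residue_sym rC) RC'.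
have [eC rC] := gC.2 _ RC'.
have lA' : lmin K (d A' C') by apply/(gate_lmin _ rA').
have rA : reduced_mul (g t) (d A' C') by apply/descentN/lA'.
have eAC' : d A C' = g t * d A' C' by apply: wdist_cons.
have dt : descent t (d A C * d C C').
  rewrite -eC eAC'; rewrite /descent genK rA length_gen; lia.
have [v [ev _ vL]] := exchange_parabolic uL rC dt ((descentN _ _).1 (lm t tK)).
apply: (rmin_reflection rm (u := v * (d C C')^-1)) (lm t tK) _.
  by apply: parabolicM => //; apply: parabolicV.
by rewrite cox_mulA -ev -!cox_mulA mulgV mulg1.
Qed.

Lemma proj_residue J L A B C R : residue L B = R -> gate R A C -> lmin J (d A C) ->
  [set D | exists2 C', R C' & gate (residue J A) C' D] =
  residue (proj_type J L (d A C)) A.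
Proof.
move=> eR gC lm; have IJ : proj_type J L (d A C) \subset J.
  by apply/fintype.subsetP => t; rewrite finset.inE => /andP[].
have rm : rmin L (d A C) by have := gC; rewrite -eR => gC'; apply/(gate_rmin _ gC'.1).
apply/seteqP; split=> D; last first.
  move=> rD; have [|C' [gC' e _]] := @transports_proj _ L A B C R eR gC _ D rD.
    split; first exact: lminS IJ lm.
    by move=> t; rewrite finset.inE => /andP [_ /asboolP].
  exists C'; first exact: gC'.1.
  by apply/(gate_lmin _ (residueS IJ rD)); rewrite e.
move=> /= [C' RC' gD].
have uL : parabolic L (d C C').
  have := gC.1; rewrite -eR => rC; rewrite -eR in RC'.
  exact: residue_trans (residue_sym rC) RC'.
have [k [v [kI _ e lv]]] := double_coset_split rm lm uL.
have [eC _] := gC.2 _ RC'; rewrite e in eC.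
have [D' e1 e2] := wdist_split eC (lmin_reduced lv (parabolicS IJ kI)).
have rD' : residue (proj_type J L (d A C)) A D' by rewrite /residue /= e1.
suff -> : D = D' by [].
by apply: gate_unique gD _; apply/(gate_lmin _ (residueS IJ rD')); rewrite e2.
Qed.

(** Project [B] to [A], and [A] back to [C] in [R]: d A C is a prefix of d A B, hence minimal on
    both sides, as [proj_residue] requires. *)
Lemma proj_set_residue J L A0 B R : residue L B = R ->
  exists I A, [/\ I \subset J, residue J A0 A &
    [set D | exists2 C', R C' & gate (residue J A0) C' D] = residue I A].
Proof.
move=> eR; have [A gA] := gate_ex J A0 B.
have [C gC] := gate_ex L B A.
have RB : residue L B B by apply: residue_refl.
have rA := gA.1; have := gA; rewrite (residue_eq rA).
move=> /(gate_lmin _ (residue_refl _ _)) lA.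
have lm : lmin J (d A C).
  by apply: lmin_prefix lA _; apply/weak_leP; exists (d C B); have [] := gC.2 _ RB.
rewrite eR in gC; exists (proj_type J L (d A C)), A; split=> //.
  by apply/fintype.subsetP => t; rewrite finset.inE => /andP[].
  exact: residue_refl.
exact: proj_residue eR gC lm.
Qed.

Lemma projE (sigma R : sphres X) :
  val (val (proj sigma R)) = [set D | exists2 C, val R C & gate (val sigma) C D].
Proof.
have [J [A0 [fJ eJ]]] := sphresP sigma; have [L [B [_ eL]]] := sphresP R.
have [I [A [IJ AA e]]] := proj_set_residue J A0 (esym eL); rewrite -eJ in e.
have fI : finite_set (parabolic I : set W).
  by apply: sub_finite_set fJ => u; apply: parabolicS.
have [P eP] := residue_sphres A fI.
have starP : P \in star sigma.
  rewrite inE /star /= /face eP eJ (residue_eq AA); exact: residueS.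
set Q := [set D | _] in e *.
have eQ : Q = [set D | exists2 C, val R C & is_proj_chamber sigma C D].
  by apply/seteqP; split=> D [C RC /is_proj_chamberP h]; exists C.
pose P' : star sigma := exist (fun R' : sphres X => R' \in star sigma) P starP.
have hP : [set P0 : star sigma | val (val P0) =
    [set D | exists2 C, val R C & is_proj_chamber sigma C D]] P'.
  by rewrite /= eP -e.
by rewrite eQ; exact: (xgetI _ hP).
Qed.

End BuildingTheory.

(** * Residues reached from a residue *)

Section Limits.
Context {W : coxeter_system} (X : building W).
Local Notation S := (cox_index W).
Local Notation g := (@cox_gen W).
Local Notation l := (@cox_length W).
Local Notation d := (@wdist W X).
Local Notation "x * y" := (@mul W x y) : group_scope.
Local Notation proj := (@Defs.proj W X).
Implicit Types (u v w : W) (s t : S) (J K L I : {set S}) (A B C D : X).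
Implicit Types (rho sigma tau x y z : sphres X).
Variable xi : star_product X.

Definition limit_residue sigma : sphres X := val (xi sigma : star sigma).

(** [reach x] is the set denoted Q'(x) above. *)
Inductive reach x : sphres X -> Prop :=
| reach_refl : reach x x
| reach_face sigma tau : reach x sigma -> face tau sigma -> reach x tau
| reach_lim sigma : reach x sigma -> reach x (limit_residue sigma).

Lemma reach_trans x y z : reach x y -> reach y z -> reach x z.
Proof.
move=> xy; elim=> {z} [//|sigma tau _ h f|sigma _ h]; first exact: reach_face f.
exact: reach_lim.
Qed.

Variable R : nat -> sphres X.
Hypothesis Rxi : converges_to R xi.

Lemma lim_sub sigma : val (limit_residue sigma) `<=` val sigma.
Proof. by have := valP (xi sigma : star sigma); rewrite inE. Qed.

Lemma limE sigma : \forall n \near \oo,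
  val (limit_residue sigma) = [set D | exists2 C, val (R n) C & gate (val sigma) C D].
Proof.
have [N NP] := Rxi sigma; exists N => // n /= /NP e.
by rewrite -projE e.
Qed.

(* [proj_rho (R n) = rho] for large [n]. *)
Definition parallel (rho : set X) := \forall n \near \oo,
  forall A, rho A -> exists2 C, val (R n) C & gate rho C A.

Lemma lim_parallel sigma : parallel (val (limit_residue sigma)).
Proof.
apply: filterS (limE sigma) => n e A; move: (@lim_sub sigma) => sub hA.
have := hA; rewrite {1}e => -[C RC gA]; exists C => //.
exact: gate_sub gA.
Qed.

Lemma sphres_gate_ex rho A : exists C, gate (val rho) A C.
Proof. by have [J [B [_ ->]]] := sphresP rho; apply: gate_ex. Qed.

(* [c] is the chamber at position [j] on the minimal galleries from [A] to
   [R n] for all large [n]. *)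
Definition ahead A (j : W) (c : X) := d A c = j /\ \forall n \near \oo,
  forall C, gate (val (R n)) A C -> d A C = j * d c C /\ reduced_mul j (d c C).

Lemma ahead_unique A j c c' : ahead A j c -> ahead A j c' -> c = c'.
Proof.
move=> [e h] [e' h']; have [n [hn hn']] := filter_ex (filterI h h').
have [C gC] := sphres_gate_ex (R n) A.
have [e1 r1] := hn C gC; have [e2 r2] := hn' C gC.
apply: (@wdist_split_unique _ X A c c' C); rewrite ?e ?e' //.
by apply: (mulgI j); rewrite -[LHS]e1 -[RHS]e2.
Qed.

Lemma ahead_mul A B i j c : d A B = i -> reduced_mul i j -> ahead B j c ->
  (\forall n \near \oo, forall C, gate (val (R n)) A C ->
     [/\ gate (val (R n)) B C, d A C = i * d B C & reduced_mul i (d B C)]) ->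
  ahead A (i * j) c.
Proof.
move=> eAB ij [eBc h] h'; split; first by rewrite (@wdist_comp _ X A B c) eAB eBc.
apply: filterS2 h h' => n h h' C /h' [/h [e r] -> iB].
rewrite e in iB *; rewrite -cox_mulA; split=> //.
by have [] := reduced_mulAr r iB.
Qed.

Lemma step_rmin K s wK wJ : lmin K (wK * wJ) ->
  rmin (step_type K s wK wJ) (wK * wJ).
Proof.
move=> lm; apply/rmin_lmin => t /step_typeP [t0 t0K e].
have := lm t0 t0K; rewrite /descent e -lengthV lengthV.
by rewrite -(lengthV (_ * g t)) cox_invM gen_inv -(lengthV (wK * wJ)).
Qed.

Lemma parallel_transports rho K L A B C n : val rho = residue K A ->
  val (R n) = residue L B ->
  (forall A, val rho A -> exists2 C, val (R n) C & gate (val rho) C A) ->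
  gate (val (R n)) A C -> transports K L (d A C).
Proof.
move=> erho eR par gC; apply: (proj_transports (esym eR) gC).
by move=> A' rA'; rewrite -erho in rA' *; apply: par.
Qed.

(** * One forward move from a parallel residue *)

Section Step.
Variables (rho tau : sphres X) (K : {set S}) (s : S) (wK wJ : W) (n : nat).
Local Notation J := (s |: K)%SET.
Local Notation i := (wK * wJ).
Local Notation K1 := (step_type K s wK wJ).
Hypotheses (lK : is_longest K wK) (lJ : is_longest J wJ).
Hypothesis par :
  forall A, val rho A -> exists2 C, val (R n) C & gate (val rho) C A.
Hypothesis lim_n :
  val (limit_residue tau) = [set D | exists2 C, val (R n) C & gate (val tau) C D].

(** [B] is the chamber after the prefix [i] of d A C. The rest d B C is minimal both for [J] and on
    the side of [R n], so [proj_residue] computes the projection of [R n] to [tau] at [B]; its type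
    is [step_type]. *)
Lemma step_lim A C : val rho = residue K A -> val tau = residue J A ->
  gate (val (R n)) A C -> descent s (d A C) ->
  exists B, [/\ d A B = i,
    gate (val (R n)) B C /\ gate (val (limit_residue tau)) A B,
    val (limit_residue tau) = residue K1 B &
    d A C = i * d B C /\ reduced_mul i (d B C)].
Proof.
move=> erho etau gC ds; have [L [C0 [_ eL]]] := sphresP (R n).
have tr := parallel_transports erho eL par gC.
have rm : rmin L (d A C).
  by have gC' := gC; rewrite eL in gC'; apply/(gate_rmin _ gC'.1).
have [m [em im _ lm]] := step_split lK lJ tr ds.
have [B eB eBC] := wdist_split em im.
have gB : gate (val (R n)) B C.
  have RC := gC.1; rewrite eL in RC *; apply/(gate_rmin _ RC); rewrite eBC.
  by apply: (rmin_suffix im); rewrite -em.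
have AB : residue J A B.
  rewrite /residue /= eB; apply: parabolicM lJ.1.
  exact: parabolicS (finset.subsetU1 _ _) lK.1.
have elim : val (limit_residue tau) = residue K1 B.
  rewrite lim_n etau (residue_eq AB) (proj_residue (esym eL) gB) ?eBC //.
  congr residue; apply/finset.setP => t; apply/idP/idP.
    rewrite finset.inE => /andP [tJ /asboolP [t' t'L e]].
    exact: (step_type_max lK lJ tr rm ds em tJ t'L e).
  move=> tK1; have [_ /(_ t tK1) [t' t'L e]] := step_transports lK lJ tr ds em.
  rewrite finset.inE (fintype.subsetP (step_type_sub _ _ _ _) _ tK1) /=.
  by apply/asboolP; exists t'.
exists B; split=> //; last by rewrite eBC.
split=> //; rewrite elim; apply/(gate_rmin _ (residue_refl _ _)); rewrite eB.
apply: step_rmin; apply: lmin_prefix tr.1 _; apply/weak_leP.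
by exists m.
Qed.

End Step.

(* By induction on [j]: if [s] is a descent of [j], hence of all of [T], then
   passing from [rho] to its face [tau] of type [K] + [s], and from there to
   [xi(tau)], moves [rho] forward along the common prefix [w_K w_(K+s)]. *)
Lemma parallel_advance rho K A (T : set W) j : val rho = residue K A ->
  finite_set (parabolic K : set W) -> parallel (val rho) -> T !=set0 ->
  (forall w, T w -> transports K [set: S]%SET w) ->
  (\forall n \near \oo, forall B C, val rho B -> gate (val (R n)) B C -> T (d B C)) ->
  is_glb T j ->
  exists rho', [/\ reach rho rho', parallel (val rho') &
    forall B, val rho B -> exists2 c, val rho' c & ahead B j c].
Proof.
have [N] := ubnP (l j); elim: N => // N IH in rho K A T j *.
move=> lj erho fK par [w0 Tw0] TK ev glbj.
have [->|/eqP/exists_descent [s sj]] := eqVneq j 1.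
  exists rho; split=> //; first exact: reach_refl.
  move=> B rB; exists B => //; split; first exact: wdistxx.
  by apply: nearW => n C _; rewrite mul1g; split=> //; apply: reduced_mul1l.
have sT w : T w -> descent s w by move=> /glbj.1; apply: descent_weak_le.
have [wK lK] := longest_ex fK.
have fJ := step_finite lK (TK _ Tw0) (sT _ Tw0).
have [wJ lJ] := longest_ex fJ.
have [tau etau] := residue_sphres A fJ.
set i := wK * wJ; set K1 := step_type K s wK wJ.
(* [T'] holds what remains of the elements of [T] after the prefix [i]; its meet is [j] with [i]
   stripped. *)
pose T' := [set m | T (i * m)].
have split_T w : T w -> exists m, [/\ w = i * m, reduced_mul i m & T' m].
  move=> Tw; have [m [em im _ _]] := step_split lK lJ (TK _ Tw) (sT _ Tw).
  by exists m; split=> //; rewrite /T' /= -em.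
have redT' m : T' m -> reduced_mul i m.
  by move=> /split_T [m' [/mulgI -> ]].
have T'0 : T' !=set0 by have [m [_ _ Tm]] := split_T _ Tw0; exists m.
have [|j' [ej ij' glbj']] := @glb_mul W T T' i j _ redT' glbj T'0.
  move=> w; split=> [/split_T [m [-> _ Tm]]|[m Tm ->] //]; by exists m.
have lj' : (l j' < N)%N.
  (* If [i] were trivial, [w0] would equal its remainder m, which has no descent in [J], whereas s
     is a descent of [w0]. *)
  suff : l i <> 0%N by move: ij' lj; rewrite /reduced_mul -ej; lia.
  move=> /length_eq0 ei; have [m [em _ _ lm]] := step_split lK lJ (TK _ Tw0) (sT _ Tw0).
  have := sT _ Tw0; rewrite em -/i ei mul1g; apply/negP; apply: lm.
  by rewrite finset.setU11.
have step n B C :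
    (forall A, val rho A -> exists2 C, val (R n) C & gate (val rho) C A) ->
    val (limit_residue tau) = [set D | exists2 C, val (R n) C & gate (val tau) C D] ->
    (forall B C, val rho B -> gate (val (R n)) B C -> T (d B C)) ->
    val rho B -> gate (val (R n)) B C ->
    exists B', [/\ d B B' = i,
      gate (val (R n)) B' C /\ gate (val (limit_residue tau)) B B',
      val (limit_residue tau) = residue K1 B' &
      d B C = i * d B' C /\ reduced_mul i (d B' C)].
  move=> parn limn evn rB gC; have AB : residue K A B by rewrite -erho.
  apply: (step_lim lK lJ parn limn) => //.
  - by rewrite erho; apply: residue_eq.
  - by rewrite etau; apply: residue_eq; apply: residueS AB; apply: finset.subsetU1.
  - by apply: sT; apply: evn.
have rA : val rho A by rewrite erho; apply: residue_refl.
have good : \forall n \near \oo, [/\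
    forall A, val rho A -> exists2 C, val (R n) C & gate (val rho) C A,
    val (limit_residue tau) = [set D | exists2 C, val (R n) C & gate (val tau) C D] &
    forall B C, val rho B -> gate (val (R n)) B C -> T (d B C)].
  by move: par; rewrite /parallel => par'; apply: filterS3 par' (limE tau) ev => n; split.
have [n0 [par0 lim0 ev0]] := filter_ex good.
have [C0 gC0] := sphres_gate_ex (R n0) A.
have [A' [eA' _ elim _]] := step n0 A C0 par0 lim0 ev0 rA gC0.
have [|||m Tm|||rho' [r1 r2 r3]] := IH (limit_residue tau) K1 A' T' j' lj' elim.
- by apply: sub_finite_set fJ => u; apply: parabolicS; apply: step_type_sub.
- exact: lim_parallel.
- done.
- exact: (step_transports lK lJ (TK _ Tm) (sT _ Tm)).
(* By transport, all chambers of [limit_residue tau] have the same distance to their gates on [R n],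
   so it suffices to treat the one ahead of [A]. *)
- apply: filterS good => n [parn limn evn] B C rB gC.
  have [C1 gC1] := sphres_gate_ex (R n) A.
  have [A1 [_ [gA1 _] elim1 [eC1 _]]] := step n A C1 parn limn evn rA gC1.
  have [L [B0 [_ eL]]] := sphresP (R n).
  have trA := parallel_transports erho eL parn gC1.
  have tr := step_transports lK lJ trA (sT _ (evn _ _ rA gC1)) eC1.
  rewrite elim1 in rB; have [C2 [gC2 e2 _]] := transports_proj (esym eL) gA1 tr rB.
  by rewrite (gate_unique gC gC2) e2 /T' /= -eC1; apply: evn.
- exact: glbj'.
exists rho'; split=> //.
  apply: reach_trans r1; apply: reach_lim; apply: reach_face (reach_refl _) _.
  by rewrite /face erho etau; apply: residueS; apply: finset.subsetU1.
move=> B rB; have [C1 gC1] := sphres_gate_ex (R n0) B.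
have [B' [eB' [_ gB'] _ _]] := step n0 B C1 par0 lim0 ev0 rB gC1.
have [c rc ac] := r3 B' gB'.1; exists c => //; rewrite ej.
apply: ahead_mul eB' ij' ac _.
apply: filterS good => n [parn limn evn] C gC.
(* The chambers found at [n0] and at n are both the gate of [B] on [limit_residue tau], so [B']
   serves all large n. *)
have [B2 [eB2 [gB2 gB2'] _ [e2 i2]]] := step n B C parn limn evn rB gC.
by rewrite (gate_unique gB' gB2').
Qed.

(** * Meets of positions and their chambers *)

Definition positions N A : set W :=
  [set w | exists2 n, (N <= n)%N & exists2 C, gate (val (R n)) A C & w = d A C].

Lemma positions_neq0 N A : positions N A !=set0.
Proof.
have [C gC] := sphres_gate_ex (R N) A.
by exists (d A C), N => //; exists C.
Qed.

(** Here [c] is c_N(A) and [j] is j_N(A). *)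
Definition meet_chamber N A c := exists2 j, is_glb (positions N A) j & ahead A j c.

Lemma meet_chamber_unique N A c c' :
  meet_chamber N A c -> meet_chamber N A c' -> c = c'.
Proof.
by move=> [j gj aj] [j' gj' aj']; apply: ahead_unique aj _; rewrite (glb_unique gj gj').
Qed.

Lemma parallel_meet rho : parallel (val rho) -> \forall N \near \oo,
  exists rho', [/\ reach rho rho', parallel (val rho') &
    forall A, val rho A -> exists2 c, val rho' c & meet_chamber N A c].
Proof.
move=> par; have [N0 _ parN0] := par; exists N0 => // N /= leN.
have [A rA] := sphres_inhabited rho; have [K [fK erho]] := sphres_residue rA.
have [j gj] := glb_ex (positions_neq0 N A).
have trA n C : (N <= n)%N -> gate (val (R n)) A C ->
    exists L B, val (R n) = residue L B /\ transports K L (d A C).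
  move=> len gC; have [L [B [_ eL]]] := sphresP (R n); exists L, B; split=> //.
  by apply: (parallel_transports erho eL _ gC); apply: parN0; apply: leq_trans len.
(* By transport, all chambers of [rho] have the same distance to their gates on [R n]; so they share
   their positions and the meet [j]. *)
have same n B C : (N <= n)%N -> val rho B -> gate (val (R n)) B C ->
    forall C', gate (val (R n)) A C' -> d B C = d A C'.
  move=> len rB gC C' gC'; have [L [B0 [eL tr]]] := trA _ _ len gC'.
  rewrite erho in rB; have [C2 [gC2 <- _]] := transports_proj (esym eL) gC' tr rB.
  by rewrite (gate_unique gC gC2).
have samepos B : val rho B -> positions N B = positions N A.
  move=> rB; apply/seteqP; split=> w [n len [C gC ->]]; exists n => //.
    have [C' gC'] := sphres_gate_ex (R n) A; exists C' => //; exact: same gC _ gC'.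
  have [C' gC'] := sphres_gate_ex (R n) B; exists C' => //.
  by rewrite (same n B C' len rB gC' C gC).
have [||rho' [r1 r2 r3]] := parallel_advance erho fK par (positions_neq0 N A) _ _ gj.
- move=> w [n len [C gC ->]]; have [L [B [_ tr]]] := trA _ _ len gC.
  exact: transports_setT tr.
- exists N => // n /= len B C rB gC; exists n => //.
  by have [C' gC'] := sphres_gate_ex (R n) A; exists C' => //; apply: same gC _ gC'.
exists rho'; split=> // B rB; have [c rc ac] := r3 B rB.
by exists c => //; exists j => //; rewrite samepos.
Qed.

Lemma parallel_chamber A : exists2 rho : sphres X, val rho = [set A] & parallel (val rho).
Proof.
have [|rho erho] := @residue_sphres W X finset.set0 A.
  apply: sub_finite_set (finite_set1 (1 : W)) => u; exact: parabolic_set0.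
have e : val rho = [set A].
  rewrite erho; apply/seteqP; split=> D; first by move=> /residue_set0 ->.
  by move=> ->; apply: residue_refl.
exists rho => //; rewrite e /parallel; apply: nearW => n _ ->.
have [C RC] := sphres_inhabited (R n); exists C => //; split=> // _ ->.
by rewrite wdistxx mulg1; split=> //; apply: reduced_mul1r.
Qed.

(** For large n all of [R n] projects to [V], so a minimal gallery from [A] to [R n] can start with
    the step to [V]. The positions of [A] are thus s times those of [V], and so are the meets; both
    lead to the same chamber. *)
Lemma meet_chamber_cons A V (sigma : set X) s : d A V = g s -> sigma A ->
  (\forall n \near \oo, forall C, val (R n) C -> gate sigma C V) ->
  \forall N \near \oo, forall c, meet_chamber N V c -> meet_chamber N A c.
Proof.
move=> eAV sA [N0 _ gV].
have key n C : (N0 <= n)%N -> gate (val (R n)) V C ->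
    [/\ gate (val (R n)) A C, d A C = g s * d V C & reduced_mul (g s) (d V C)].
  move=> len gC; have red D : val (R n) D ->
      d A D = g s * d V D /\ reduced_mul (g s) (d V D).
    move=> RD; have [_ r] := (gV n len D RD).2 A sA.
    move/reduced_mulV: r; rewrite -!wdistV eAV => r; split=> //.
    exact: wdist_cons.
  have [eC rC] := red C gC.1; split=> //; split=> [|D RD]; first exact: gC.1.
  have [eD rD] := red D RD; have [e r] := gC.2 D RD.
  rewrite eD e eC cox_mulA; split=> //.
  by rewrite e in rD; have [] := reduced_mulAr r rD.
have key' n C : (N0 <= n)%N -> gate (val (R n)) A C ->
    [/\ gate (val (R n)) V C, d A C = g s * d V C & reduced_mul (g s) (d V C)].
  move=> len gC; have [C' gC'] := sphres_gate_ex (R n) V.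
  have [gAC' e r] := key n C' len gC'.
  by rewrite (gate_unique gC gAC').
exists N0 => // N /= leN c [k gk ak].
have [j gj] := glb_ex (positions_neq0 N A).
have redpos v : positions N V v -> reduced_mul (g s) v.
  by move=> [n len [C gC ->]]; have [] := key n C (leq_trans leN len) gC.
have [|k' [ej rk' gk']] :=
  @glb_mul W _ (positions N V) (g s) j _ redpos gj (positions_neq0 N V).
  move=> w; split=> [[n len [C gC ->]]|[v [n len [C gC ->]] ->]].
    have [gVC -> _] := key' n C (leq_trans leN len) gC.
    by exists (d V C) => //; exists n => //; exists C.
  have [gAC e _] := key n C (leq_trans leN len) gC.
  by exists n => //; exists C.
rewrite (glb_unique gk' gk) in ej rk'.
exists j => //; rewrite ej; apply: ahead_mul eAV rk' ak _.
by exists N0 => // n /= len C gC; apply: key'.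
Qed.

(* All the walls of [rho1] and [rho2] meet [R n] for large [n], hence generate
   a group conjugate into the finite stabilizer type of [R n]. *)
Lemma parallel_union (rho1 rho2 : sphres X) c : parallel (val rho1) ->
  parallel (val rho2) -> val rho1 c -> val rho2 c ->
  exists rho : sphres X,
    [/\ parallel (val rho), val rho1 `<=` val rho & val rho2 `<=` val rho].
Proof.
move=> par1 par2 /sphres_residue [K1 [_ e1]] /sphres_residue [K2 [_ e2]].
pose K := (K1 :|: K2)%SET.
have tr : \forall n \near \oo, forall C, gate (val (R n)) c C ->
    exists L B, [/\ val (R n) = residue L B, finite_set (parabolic L : set W) &
      transports K L (d c C)].
  move: par1 par2; rewrite /parallel => q1 q2.
  apply: filterS2 q1 q2 => n p1 p2 C gC; have [L [B [fL eL]]] := sphresP (R n).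
  exists L, B; split=> //.
  have [m1 t1] := parallel_transports e1 eL p1 gC.
  have [m2 t2] := parallel_transports e2 eL p2 gC.
  by split=> t; rewrite finset.in_setU => /orP []; auto.
have [n0 tr0] := filter_ex tr; have [C0 gC0] := sphres_gate_ex (R n0) c.
have [L [B [_ fL trL]]] := tr0 C0 gC0.
have fK : finite_set (parabolic K : set W).
  apply: sub_finite_set (finite_image (fun u => d c C0 * u * (d c C0)^-1) fL).
  move=> k kK; have [x [xL ex _ _]] := transports_conj trL kK.
  by exists x => //; rewrite -ex -cox_mulA mulgV mulg1.
have [rho erho] := residue_sphres c fK; exists rho; split.
- rewrite erho /parallel; apply: filterS tr => n trn A rA.
  have [C gC] := sphres_gate_ex (R n) c; have [L' [B' [eL' _ tr']]] := trn C gC.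
  have [C' [gC' _ gA]] := transports_proj (esym eL') gC tr' rA.
  by exists C' => //; case: gC'.
- by rewrite e1 erho; apply: residueS; apply: finset.subsetUl.
- by rewrite e2 erho; apply: residueS; apply: finset.subsetUr.
Qed.

(** * Linking meet chambers along a gallery *)

Definition linked N A B := exists (rho : sphres X) c c', [/\ parallel (val rho),
  val rho c, val rho c', meet_chamber N A c & meet_chamber N B c'].

(** For fixed N, both residues contain the unique chamber c_N(B), so [parallel_union] merges
    them. *)
Lemma linked_trans N A B C : linked N A B -> linked N B C -> linked N A C.
Proof.
move=> [rho1 [a [b [p1 ra rb ma mb]]]] [rho2 [b' [c [p2 rb' rc mb' mc]]]].
rewrite -(meet_chamber_unique mb mb') in rb'.
have [rho [p s1 s2]] := parallel_union p1 p2 rb rb'.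
by exists rho, a, c; split=> //; [apply: s1|apply: s2].
Qed.

Lemma linked_refl A : \forall N \near \oo, linked N A A.
Proof.
have [rho e par] := parallel_chamber A.
apply: filterS (parallel_meet par) => N [rho' [_ par' h]].
have [|c rc mc] := h A; first by rewrite e.
by exists rho', c, c.
Qed.

Lemma parabolic_set1 s u : parabolic [set s]%SET u -> u = 1 \/ u = g s.
Proof.
move: u; apply: parabolic_ind => [|t u]; first by left.
rewrite finset.in_set1 => /eqP -> _ r [->|e]; first by right; rewrite mulg1.
by move: r; rewrite e /reduced_mul cox_gen_sq length1 length_gen.
Qed.

Lemma linked_adjacent A B s : d A B = g s -> \forall N \near \oo, linked N A B.
Proof.
move=> eAB; pose J := [set s]%SET.
have fJ : finite_set (parabolic J : set W).
  apply: (@descents_finite W J (g s)) => t; rewrite finset.in_set1 => /eqP ->.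
  by rewrite /descent cox_gen_sq length1 length_gen.
have [sigma es] := residue_sphres A fJ.
have sA : val sigma A by rewrite es; apply: residue_refl.
have sB : val sigma B.
  by rewrite es /residue /= eAB; apply: parabolic_gen; rewrite finset.in_set1.
have [n0 limn0] := filter_ex (limE sigma).
have [L [B0 [_ eL]]] := sphresP (R n0).
have [I [V [IJ AV e]]] := proj_set_residue J A (esym eL).
rewrite es e in limn0.
have sV : val sigma V by rewrite es.
(* The limit of the panel is either the whole panel, which is then parallel, or the single chamber
   [V]. *)
have [sI|sI] := boolP (s \in I).
  have eI : I = J by apply/eqP; rewrite finset.eqEsubset IJ finset.sub1set.
  have par : parallel (val sigma).
    have := @lim_parallel sigma; rewrite limn0 eI.
    by rewrite -(residue_eq AV) -es.
  apply: filterS (parallel_meet par) => N [rho [_ p h]].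
  by have [c rc mc] := h A sA; have [c' rc' mc'] := h B sB; exists rho, c, c'.
have eI : I = finset.set0.
  apply/finset.setP => t; rewrite finset.in_set0; apply: contraNF sI => tI.
  by have := fintype.subsetP IJ t tI; rewrite finset.in_set1 => /eqP <-.
have gV : \forall n \near \oo, forall C, val (R n) C -> gate (val sigma) C V.
  apply: filterS (limE sigma) => n e1 C RC; have [D gD] := sphres_gate_ex sigma C.
  have : val (limit_residue sigma) D by rewrite e1; exists C.
  by rewrite limn0 eI => /residue_set0 ->.
have toV D : val sigma D -> \forall N \near \oo, forall c,
    meet_chamber N V c -> meet_chamber N D c.
  move=> sD; have : residue J D V.
    by rewrite es in sD sV; apply: residue_trans (residue_sym sD) sV.
  move=> /parabolic_set1 [/wdist_eq1 ->|eDV]; first by apply: nearW.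
  exact: meet_chamber_cons eDV sD gV.
apply: filterS3 (linked_refl V) (toV A sA) (toV B sB).
move=> N [rho [c [c' [p rc _ mc _]]]] hA hB.
by exists rho, c, c; split=> //; [apply: hA|apply: hB].
Qed.

Lemma eventually_linked A B : \forall N \near \oo, linked N A B.
Proof.
have [p + _] := gallery_ex A B; move=> [+ <-].
elim: p A => [|A' p IH] A /=; first by move=> _; apply: linked_refl.
move=> /andP [/asboolP [s /linked_adjacent h] /IH h'].
by apply: filterS2 h h' => N; apply: linked_trans.
Qed.

Lemma reach_common x y : exists2 z, reach x z & reach y z.
Proof.
have [A xA] := sphres_inhabited (limit_residue x).
have [B yB] := sphres_inhabited (limit_residue y).
have [N [[hx hy] [rho [c [c' [p rc rc' mc mc']]]]]] := filter_ex (filterI (filterI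
  (parallel_meet (@lim_parallel x)) (parallel_meet (@lim_parallel y)))
  (eventually_linked A B)).
have [rx [xrx px /(_ A xA) [cx rcx mcx]]] := hx.
have [ry [yry py /(_ B yB) [cy rcy mcy]]] := hy.
rewrite (meet_chamber_unique mcx mc) in rcx.
rewrite (meet_chamber_unique mcy mc') in rcy.
(* [rx] and [rho] share c_N(A), [ry] and [rho] share c_N(B); merging all three gives a face z of
   both [rx] and [ry]. *)
have [r1 [p1 s1 s1']] := parallel_union px p rcx rc.
have [z [pz s2 s2']] := parallel_union p1 py (s1' _ rc') rcy.
exists z.
  apply: reach_trans (reach_lim (reach_refl x)) _; apply: reach_face xrx _.
  by move=> C /s1 /s2.
by apply: reach_trans (reach_lim (reach_refl y)) _; apply: reach_face yry _.
Qed.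

End Limits.

(** * Convex hulls and sectors *)

Section Sectors.
Context {W : coxeter_system} (X : building W).
Implicit Types (x y z : sphres X) (R : nat -> sphres X).

Lemma conv_convex x y : res_convex (conv x y).
Proof.
split=> [R1 R2 f h M Mc|R1 R2 h1 h2 M Mc]; first exact: (Mc.1.1 R1 R2 f (h M Mc)).
exact: (Mc.1.2 R1 R2 (h1 M Mc) (h2 M Mc)).
Qed.

Lemma conv_left x y : conv x y x.
Proof. by move=> M [_ h]; apply: h; left. Qed.

Lemma conv_right x y : conv x y y.
Proof. by move=> M [_ h]; apply: h; right. Qed.

Lemma conv_sub x y z : conv x y z -> conv z y `<=` conv x y.
Proof.
move=> h w; apply; split; first exact: conv_convex.
by move=> _ [->|->] //; apply: conv_right.
Qed.

(** [conv x (R n)] is convex and contains [R n], so with sigma it contains proj_sigma(R n), which is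
    xi(sigma) for large n. *)
Lemma reach_seq_sector (xi : star_product X) R x z : converges_to R xi ->
  reach xi x z -> seq_sector x R z.
Proof.
move=> Rxi; elim=> {z} [|sigma tau _ [k _ h] f|sigma _ [k _ h]].
- by exists 0%N => // n _; apply: conv_left.
- by exists k => // n kn; apply: (conv_convex x (R n)).1 f (h n kn).
have [N NP] := Rxi sigma; exists (maxn k N) => // n /=.
rewrite geq_max => /andP [kn Nn]; rewrite /limit_residue -(NP n Nn).
by apply: (conv_convex x (R n)).2; [apply: h|apply: conv_right].
Qed.

Lemma seq_sector_sub R x z : seq_sector x R z -> seq_sector z R `<=` seq_sector x R.
Proof.
move=> [k _ h] w [k' _ h']; exists (maxn k k') => // n /=.
by rewrite geq_max => /andP [kn kn']; apply: conv_sub (h n kn) _ (h' n kn').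
Qed.

Lemma reach_sector (xi : star_product X) x z : reach xi x z -> sector z xi `<=` sector x xi.
Proof.
move=> xz w [R Rxi h]; exists R => //.
by apply: seq_sector_sub h; apply: reach_seq_sector Rxi xz.
Qed.

End Sectors.

Theorem proposition2p30 (W : coxeter_system) (X : building W)
    (xi : star_product X) (hxi : bordification X xi) (x y : sphres X) :
  exists z : sphres X, sector z xi `<=` sector x xi `&` sector y xi.
Proof.
have [[R Rxi]|noR] := pselect (exists R, converges_to R xi); last first.
  (* [sector] is a union over the sequences converging to [xi]; if there is none it is empty, and
     any z works. *)
  by exists x => w [R Rxi]; case: noR; exists R.
have [z xz yz] := reach_common Rxi x y.
by exists z => w h; split; [apply: reach_sector xz w h|apply: reach_sector yz w h].
Qed.
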